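(* Let $\mathbb{K}$ be an uncountable algebraically closed field, let $A=\mathbb{K}[\![x_1,\dots,x_n]\!]$ with maximal ideal $\mathfrak{m}$, and let $X$ be an equidimensional closed subvariety of $\operatorname{Spec}(A)$. Let $ZD(X)\subset A$ denote the set of elements of $A$ whose image in $\mathcal{O}_X$ is a zero divisor. Let $P\subset A$ be an algebraic $\mathfrak{m}$-adically closed class such that $ZD(X)\cap P=\emptyset$. Let $(h_i)_{i\ge 1}$ be an infinite sequence of elements of $P$, with $H_i=\operatorname{Spec}(A/\langle h_i\rangle)$, such that every $\Sigma_{X\cap H_i}$ has dimension $d$ and the multiplicity of $\Sigma_{X\cap H_i}$ tends to $\infty$ as $i\to\infty$. Then there exists $h\in P$, with $H=\operatorname{Spec}(A/\langle h\rangle)$, such that $\Sigma_{X\cap H}$ has dimension $\ge d+1$.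
   Context: A closed subvariety of $\operatorname{Spec}(A)$ is a reduced closed subscheme $X=\operatorname{Spec}(A/I(X))$; equidimensional means all irreducible components have the same dimension. $0$ is counted as a zero divisor. Intersections $X\cap H$ are scheme-theoretic, i.e. $X\cap H=\operatorname{Spec}(A/(I(X)+\langle h\rangle))$. Algebraic $\mathfrak{m}$-adically closed (A$\mathfrak{m}$AC) class: a subset $P\subset A$ such that $P=\varprojlim P_i$, where each $P_i\subset A/\mathfrak{m}^i$ is Zariski constructible ($A/\mathfrak{m}^i$ being regarded as a finite-dimensional affine space over $\mathbb{K}$) and the projections $A/\mathfrak{m}^{i+1}\to A/\mathfrak{m}^i$ map $P_{i+1}$ into $P_i$; the inverse limit is regarded as a subset of $A=\varprojlim A/\mathfrak{m}^i$. Singular scheme: for a closed subscheme $Y\subset\operatorname{Spec}(A)$ with ideal $I(Y)=\langle f_1,\dots,f_k\rangle$ and an integer $\alpha$, $\Sigma^{\alpha}_Y:=\operatorname{Spec}\big(A/(I(Y)+J_{n-\alpha}(Y))\big)$, where $J_{n-\alpha}(Y)$ is the ideal generated by the $(n-\alpha)\times(n-\alpha)$ minors of the Jacobian matrix $(\partial f_i/\partial x_j)$ (this does not depend on the choice of generators). If $Y$ is equidimensional of dimension $\alpha$, $\Sigma_Y:=\Sigma^{\alpha}_Y$. (For $h\notin ZD(X)$, $X\cap H$ is equidimensional of dimension $\dim X-1$.) The multiplicity of a closed subscheme $\operatorname{Spec}(R)$, with $R$ a quotient of $A$ of dimension $d$, is $e(R,\mathfrak{m})=\lim_{k\to\infty}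 d!\,\lambda(R/\mathfrak{m}^{k+1}R)/k^d$, where $\lambda$ denotes length. *)

(* Defs.v *)
From HB Require Import structures.
From mathcomp Require Import all_boot all_order all_algebra.
From mathcomp Require Import mpoly.
From mathcomp Require Import boolp classical_sets functions cardinality.
From mathcomp Require Import reals topology normedtype sequences.

Set Implicit Arguments.
Unset Strict Implicit.
Unset Printing Implicit Defensive.

Import Order.TTheory GRing.Theory Num.Theory.
Import numFieldNormedType.Exports.

Local Open Scope classical_set_scope.
Local Open Scope ring_scope.

(* K[[x_1, ..., x_n]]: a series is its family of coefficients.  This is a
   record, not an alias for a function type, so that the convolution product
   cannot be confused with the pointwise product of functions. *)
Record pseries (n : nat) (K : Type) := PSeries { scoef : 'X_{1..n} -> K }.
Arguments PSeries {n K}.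

HB.instance Definition _ n K := gen_eqMixin (pseries n K).
HB.instance Definition _ n K := gen_choiceMixin (pseries n K).

Section PSeriesRing.
Context {n : nat} {K : comNzRingType}.
Implicit Types (f g h : pseries n K) (m : 'X_{1..n}) (p q r : {mpoly K[n]}).

Lemma pseriesP f g : scoef f =1 scoef g <-> f = g.
Proof.
by split=> [|->//]; case: f g => [f] [g] /= fg; congr PSeries; apply: funext.
Qed.

Definition pseries_zero : pseries n K := PSeries (fun=> 0).
Definition pseries_opp f : pseries n K := PSeries (fun m => - scoef f m).
Definition pseries_add f g : pseries n K :=
  PSeries (fun m => scoef f m + scoef g m).
Definition pseries_one : pseries n K := PSeries (fun m => (m == 0%MM)%:R).

(* the coefficient formula of [mcoeffM] for polynomials *)
Definition pseries_mul f g : pseries n K := PSeries (fun m =>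
  \sum_(k : 'X_{1..n < (mdeg m).+1, (mdeg m).+1} | m == (k.1 + k.2)%MM)
    scoef f k.1 * scoef g k.2).

Fact pseries_addA : associative pseries_add.
Proof. by move=> f g h; apply/pseriesP => m; exact: addrA. Qed.
Fact pseries_addC : commutative pseries_add.
Proof. by move=> f g; apply/pseriesP => m; exact: addrC. Qed.
Fact pseries_add0 : left_id pseries_zero pseries_add.
Proof. by move=> f; apply/pseriesP => m; exact: add0r. Qed.
Fact pseries_addN : left_inverse pseries_zero pseries_opp pseries_add.
Proof. by move=> f; apply/pseriesP => m; exact: addNr. Qed.

HB.instance Definition _ := GRing.isZmodule.Build (pseries n K)
  pseries_addA pseries_addC pseries_add0 pseries_addN.

Definition strunc d f : {mpoly K[n]} :=
  \sum_(m : 'X_{1..n < d}) scoef f m *: 'X_[m].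

Lemma mcoeff_strunc d f m : (mdeg m < d)%N -> (strunc d f)@_m = scoef f m.
Proof.
move=> md; rewrite raddf_sum /= (bigD1 (BMultinom md)) //= big1 => [|k km].
  by rewrite mcoeffZ mcoeffX eqxx mulr1 addr0.
rewrite mcoeffZ mcoeffX; case: eqP => [E|_]; last by rewrite mulr0.
by case/eqP: km; apply/val_inj.
Qed.

Lemma mcoeffM_cong d p q p' q' m : (mdeg m < d)%N ->
  (forall k, (mdeg k < d)%N -> p@_k = p'@_k) ->
  (forall k, (mdeg k < d)%N -> q@_k = q'@_k) -> (p * q)@_m = (p' * q')@_m.
Proof.
move=> md pp qq; rewrite !mcoeffM; apply: eq_bigr => -[a b] /= _.
by rewrite pp ?qq // (leq_trans _ md) // bmdeg.
Qed.

Lemma scoef_mul d f g m : (mdeg m < d)%N ->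
  scoef (pseries_mul f g) m = (strunc d f * strunc d g)@_m.
Proof.
move=> md; rewrite mcoeffM /=; apply: eq_bigr => -[a b] /= _.
by rewrite !mcoeff_strunc // (leq_trans _ md) // bmdeg.
Qed.

Fact pseries_mulA : associative pseries_mul.
Proof.
move=> f g h; apply/pseriesP => m; have md := ltnSn (mdeg m).
rewrite !(scoef_mul _ _ md).
set T := strunc _.
have -> : (T f * T (pseries_mul g h))@_m = (T f * (T g * T h))@_m.
  by apply: mcoeffM_cong md _ _ => // k kd; rewrite mcoeff_strunc // (scoef_mul _ _ kd).
rewrite mulrA; apply: mcoeffM_cong md _ _ => // k kd.
by rewrite mcoeff_strunc // (scoef_mul _ _ kd).
Qed.

Fact pseries_mulC : commutative pseries_mul.
Proof.
move=> f g; apply/pseriesP => m; have md := ltnSn (mdeg m).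
by rewrite !(scoef_mul _ _ md) mulrC.
Qed.

Fact pseries_mul1 : left_id pseries_one pseries_mul.
Proof.
move=> f; apply/pseriesP => m; have md := ltnSn (mdeg m).
rewrite (scoef_mul _ _ md) -(mcoeff_strunc f md) -[in RHS](mul1r (strunc _ f)).
by apply: mcoeffM_cong md _ _ => // k kd; rewrite mcoeff_strunc // mcoeff1.
Qed.

Fact pseries_mulDl : left_distributive pseries_mul +%R.
Proof.
move=> f g h; apply/pseriesP => m /=; rewrite -big_split /=.
by apply: eq_bigr => k _; rewrite mulrDl.
Qed.

Fact pseries_one_neq0 : pseries_one != 0.
Proof.
apply/eqP => /pseriesP /(_ 0%MM) /= /eqP.
by rewrite eqxx oner_eq0.
Qed.

HB.instance Definition _ := GRing.Zmodule_isComNzRing.Build (pseries n K)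
  pseries_mulA pseries_mulC pseries_mul1 pseries_mulDl pseries_one_neq0.

Definition sderiv (j : 'I_n) f : pseries n K :=
  PSeries (fun m => scoef f (m + U_(j))%MM *+ (m j).+1).

Definition smaxideal : set (pseries n K) := [set f | scoef f 0%MM = 0].

End PSeriesRing.

(* The closed subscheme Spec (A / I) of Spec A is represented by the ideal I. *)
Section Ideals.
Context {A : comNzRingType}.
Implicit Types (I J P : set A) (x y : A).

Definition is_ideal I :=
  [/\ I 0, forall x y, I x -> I y -> I (x + y) & forall a x, I x -> I (a * x)].

Definition ideal_gen (S : set A) : set A := smallest is_ideal S.

Definition ideal_add I J : set A := ideal_gen (I `|` J).

Definition ideal_exp I (k : nat) : set A :=
  ideal_gen [set x | exists2 f : 'I_k -> A,
                     forall i, I (f i) & x = \prod_(i < k) f i].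

Definition prime_ideal P :=
  [/\ is_ideal P, ~ P 1 & forall x y, P (x * y) -> P x \/ P y].

Definition radical_ideal I :=
  is_ideal I /\ forall x k, I (x ^+ k) -> I x.

(* there is a chain of d + 1 primes of A / I *)
Definition dim_ge I (d : nat) := exists p : 'I_d.+1 -> set A,
  [/\ forall i, prime_ideal (p i), forall i, I `<=` p i &
      forall i j : 'I_d.+1, (i < j)%N -> p i `<` p j].

(* The zero ring has no prime, so [has_dim] never holds for the empty scheme. *)
Definition has_dim I (d : nat) := dim_ge I d /\ ~ dim_ge I d.+1.

(* junk value 0 for the empty scheme and in infinite dimension *)
Definition krull_dim I : nat := xget 0%N (has_dim I).

Definition minimal_prime I P :=
  [/\ prime_ideal P, I `<=` P &
      forall Q, prime_ideal Q -> I `<=` Q -> Q `<=` P -> Q = P].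

(* irreducible components of Spec (A / I) = minimal primes over I *)
Definition equidimensional I :=
  exists c, forall P, minimal_prime I P -> has_dim P c.

(* The first disjunct makes 0 a zero divisor even in the zero ring. *)
Definition zero_divisors I : set A :=
  [set x | I x \/ exists2 y, ~ I y & I (x * y)].

(* chains of submodules of A / I, i.e. of ideals of A containing I *)
Definition length_ge I (l : nat) := exists J : 'I_l.+1 -> set A,
  [/\ forall i, is_ideal (J i), forall i, I `<=` J i &
      forall i j : 'I_l.+1, (i < j)%N -> J i `<` J j].

(* the length of A / I, with junk value 0 if it is infinite *)
Definition quot_length I : nat :=
  xget 0%N [set l | length_ge I l /\ ~ length_ge I l.+1].

(* e(A / I, M) for a maximal ideal M; note that
   (A / I) / M^(k+1) (A / I) = A / (I + M^(k+1)) *)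
Definition multiplicity (R : realType) (M I : set A) : R :=
  let d := krull_dim I in
  lim ((fun k : nat => d`!%:R *
          (quot_length (ideal_add I (ideal_exp M k.+1)))%:R / k%:R ^+ d : R)
       @ \oo).

End Ideals.

Section Singular.
Context {n : nat} {K : comNzRingType}.
Local Notation A := (pseries n K).
Implicit Types (I : set A) (h : A).

Definition jacobian k (f : 'I_k -> A) : 'M[A]_(k, n) :=
  \matrix_(i < k, j < n) sderiv j (f i).

(* Row and column selections are arbitrary maps: a repeated index gives 0 and
   a permutation only changes the sign, so no further ideal elements arise. *)
Definition minors r k l (M : 'M[A]_(k, l)) : set A :=
  [set x | exists (s : 'I_r -> 'I_k) (t : 'I_r -> 'I_l),
     x = \det (mxsub s t M)].

(* The ideal of Sigma^alpha_Y, for Y = Spec (A / I).  The ideal I + J_(n-alpha)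
   is the same for all finite families f generating I, so adding up all of
   them amounts to using any one of them. *)
Definition sing_ideal_at (alpha : nat) I : set A :=
  ideal_gen (I `|` [set x | exists k (f : 'I_k -> A),
                      I = ideal_gen (range f) /\
                      minors (n - alpha) (jacobian f) x]).

(* the ideal of Sigma_Y, for Y equidimensional *)
Definition sing_ideal I : set A := sing_ideal_at (krull_dim I) I.

(* the ideal of the intersection of X = Spec (A / I) with h = 0 *)
Definition hsection I h : set A := ideal_add I (ideal_gen [set h]).

End Singular.

Section Constructible.
Context {K : fieldType} {T : finType}.

(* affine space with coordinates indexed by T is T -> K *)
Definition zariski_closed (Z : set (T -> K)) :=
  exists S : set {mpoly K[#|T|]},
    Z = [set v | forall p, S p -> p.@[fun i => v (enum_val i)] = 0].

(* finite unions of locally closed sets *)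
Definition constructible (C : set (T -> K)) :=
  exists k (F G : 'I_k -> set (T -> K)),
    [/\ forall i, zariski_closed (F i), forall i, zariski_closed (G i) &
        C = \bigcup_(i in [set: 'I_k]) (F i `\` G i)].

End Constructible.

Section Jets.
Context {n : nat} {K : fieldType}.
Local Notation A := (pseries n K).

(* A / m^i, as the affine space of coefficients of monomials of degree < i;
   [jet_eqP] and [jet_surj] below identify the two. *)
Definition jets (i : nat) : Type := 'X_{1..n < i} -> K.

Definition jet (i : nat) (f : A) : jets i := fun m => scoef f m.
Arguments jet : clear implicits.

Definition bmnm_widen i (m : 'X_{1..n < i}) : 'X_{1..n < i.+1} :=
  BMultinom (leqW (bmdeg m)).

Definition jet_proj i (v : jets i.+1) : jets i := fun m => v (bmnm_widen m).

Definition AmAC (P : set A) :=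
  exists Pi : forall i : nat, set (jets i),
    [/\ forall i, constructible (Pi i),
        forall i v, Pi i.+1 v -> Pi i (jet_proj v) &
        P = [set f | forall i, Pi i (jet i f)]].

Lemma jet_surj i (v : jets i) : exists f : A, jet i f = v.
Proof.
exists (PSeries (fun m => oapp v 0 (insub m))).
by apply: funext => m; rewrite /jet /= valK.
Qed.

Lemma jet_projE i (f : A) : jet_proj (jet i.+1 f) = jet i f.
Proof. by []. Qed.

Let svar (j : 'I_n) : A := PSeries (fun m => (m == U_(j)%MM)%:R).

Let scoef_sum (I : finType) (F : I -> A) m :
  scoef (\sum_i F i) m = \sum_i scoef (F i) m.
Proof. exact: (big_morph (fun f : A => scoef f m)). Qed.

Let scoef_varM j (f : A) m :
  scoef (svar j * f) m = if m j == 0%N then 0 else scoef f (m - U_(j))%MM.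
Proof.
have md := ltnSn (mdeg m); rewrite (scoef_mul _ _ md).
set p := strunc _ f.
have -> : (strunc (mdeg m).+1 (svar j) * p)@_m = (p * 'X_j)@_m.
  rewrite mulrC; apply: mcoeffM_cong md _ _ => // k kd.
  by rewrite mcoeff_strunc // mcoeffX eq_sym.
case: (boolP (m j == 0%N)) => mj.
  rewrite mcoeffM big1 // => -[a b] /= /eqP E.
  rewrite mcoeffX; case: eqP => [jb|_]; last by rewrite mulr0.
  move/(congr1 (fun k : 'X_{1..n} => k j)): E.
  by rewrite mnmDE -jb mnm1E eqxx (eqP mj) addn1.
have mE : (U_(j) + (m - U_(j)) = m)%MM by rewrite addmC submK // lep1mP.
rewrite -{1}mE mcoeffMX mcoeff_strunc //.
by rewrite (leq_ltn_trans (mdegB _ _)).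
Qed.

Lemma ideal_gen_ideal (S : set A) : is_ideal (ideal_gen S).
Proof.
split=> [J [[]]//|x y xS yS J [JI SJ]|a x xS J [JI SJ]].
  by case: (JI) => _ + _; apply; [apply: xS|apply: yS].
by case: (JI) => _ _; apply; apply: xS.
Qed.

Lemma smaxideal_expP i (f : A) :
  ideal_exp smaxideal i f <-> forall m, (mdeg m < i)%N -> scoef f m = 0.
Proof.
split=> [|ord_f].
  apply: (@smallest_sub _ _ _
      [set f : A | forall m, (mdeg m < i)%N -> scoef f m = 0]) => [|_ [F Fm ->]].
    split=> //= [x y x0 y0 m mi|a x x0 m mi].
      by rewrite x0 // y0 // addr0.
    apply: big1 => -[[b bd] [c cd]] /= /eqP E; rewrite [scoef x _]x0 ?mulr0 //.
    by rewrite (leq_ltn_trans _ mi) // E mdegD leq_addl.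
  elim: i F Fm => [//|i IH] F Fm m mi; rewrite big_ord_recl /=.
  apply: big1 => -[[b bd] [c cd]] /= /eqP E.
  have [/eqP|b0] := eqVneq (mdeg b) 0%N.
    by rewrite mdeg_eq0 => /eqP ->; rewrite (Fm ord0) mul0r.
  rewrite [X in _ * X](IH (fun k => F (lift ord0 k))) ?mulr0 //.
  by rewrite -ltnS (leq_trans _ mi) // E mdegD ltnS -add1n leq_add2r lt0n.
elim: i f ord_f => [|i IH] f ord_f.
  have [_ _ idM] := ideal_gen_ideal [set x | exists2 f : 'I_0 -> A,
                     forall i, smaxideal (f i) & x = \prod_(i < 0) f i].
  rewrite -[f]mulr1; apply: idM; apply: sub_gen_smallest.
  by exists (fun=> 0) => [[]//|]; rewrite big_ord0.
pose low m (j : 'I_n) := [forall k : 'I_n, (k < j)%N ==> (m k == 0%N)].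
pose g (j : 'I_n) : A :=
  PSeries (fun m => if low m j then scoef f (m + U_(j))%MM else 0).
have -> : f = \sum_j svar j * g j.
  apply/pseriesP => m; rewrite scoef_sum.
  under eq_bigr do rewrite scoef_varM /=.
  have [->|/eqP m0] := eqVneq m 0%MM.
    rewrite ord_f ?mdeg0 // big1 // => j _; by rewrite mnm0E.
  have [j0 mj0] : exists j, m j != 0%N.
    apply/existsP; apply: contra_notT m0; rewrite negb_exists => /forallP m0.
    by apply/mnmP => j; rewrite mnm0E; apply/eqP; move: (m0 j); rewrite negbK.
  have [j mj jmin] := @arg_minnP _ j0 (fun j => m j != 0%N) val mj0.
  have mlow : low (m - U_(j))%MM j.
    apply/forallP => k; apply/implyP => kj.
    rewrite mnmBE; apply/eqP; have : ~~ (m k != 0%N).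
      by apply: contraL kj => /jmin; rewrite -leqNgt.
    by rewrite negbK => /eqP ->.
  rewrite (bigD1 j) //= (negbTE mj) mlow submK ?lep1mP // big1 ?addr0 // => k kj.
  have [//|mk] := boolP (m k == 0%N).
  case: ifP => // /forallP /(_ j); rewrite mnmBE mnm1E (negbTE kj) subn0.
  rewrite (negbTE mj) implybF -leqNgt => jk.
  by have := jmin k mk; rewrite leqNgt ltn_neqAle jk andbT negbK => /eqP/val_inj E;
     rewrite E eqxx in kj.
have [e0 eD eM] := ideal_gen_ideal [set x | exists2 f : 'I_i.+1 -> A,
                   forall k, smaxideal (f k) & x = \prod_(k < i.+1) f k].
apply: (big_ind (ideal_exp smaxideal i.+1)) => // j _.
have ord_g : forall m, (mdeg m < i)%N -> scoef (g j) m = 0.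
  by move=> m mi /=; case: ifP => // _; rewrite ord_f // mdegD mdeg1 addn1.
have := IH _ ord_g.
apply: (@smallest_sub _ _ _ [set y | ideal_exp smaxideal i.+1 (svar j * y)]).
  split=> /= [|x y xI yI|a x xI]; first by rewrite mulr0.
    by rewrite mulrDr; exact: eD.
  by rewrite mulrCA; exact: eM.
move=> _ [F Fm ->]; apply: sub_gen_smallest.
exists (fun k => if unlift ord0 k is Some k' then F k' else svar j).
  move=> k; case: unliftP => [k' _|_]; first exact: Fm.
  rewrite /smaxideal /= eq_sym; case: eqP => // /mnmP /(_ j).
  by rewrite mnm1E mnm0E eqxx.
by rewrite big_ord_recl unlift_none; under [in RHS]eq_bigr do rewrite liftK.
Qed.

Lemma jet_eqP i (f g : A) :
  jet i f = jet i g <-> ideal_exp smaxideal i (f - g).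
Proof.
split=> [fg|/smaxideal_expP fg].
  apply/smaxideal_expP => m mi /=; apply/eqP; rewrite subr_eq0; apply/eqP.
  exact: (congr1 (fun v : jets i => v (BMultinom mi)) fg).
apply: funext => m; apply/eqP; rewrite -subr_eq0; apply/eqP.
exact: (fg m (bmdeg m)).
Qed.

End Jets.

(* Main.v *)
Require Import Defs.
From HB Require Import structures.
From mathcomp Require Import all_boot all_order all_algebra.
From mathcomp Require Import mpoly ring zify.
From mathcomp Require Import boolp classical_sets functions cardinality.
From mathcomp Require Import reals topology normedtype sequences.

(* Let la(I, k) be the K-codimension of I + m^k in A. An ideal I satisfies
   dim (A / I) >= d if and only if la(I, s k) >= k^d for some s and all k > 0:
   primes are obtained as maximal ideals of given growth, and conversely growth
   increases along a chain of primes by the Artin-Rees lemma. In particular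
   X \cap H has dimension dim X - 1 for all non-units h of P, so that Jacobian minors of one
   and the same size define all the schemes Sigma_{X \cap H}.

   If la(J, (d+1) e) < e^(d+1), then by pigeonhole any d + 1 variables carry an
   initial monomial of J with exponents < e; this bounds la(J, l) by C l^d, with
   C depending on n, d and e only, and hence the multiplicity if dim (A / J) = d.
   As the multiplicities tend to infinity, la(Sigma_{X \cap H_i}, (d+1) e) >=
   e^(d+1) for i large, for every e.

   These lower bounds and the membership in P are countably many algebraic
   conditions on the coefficients of h. Take the coefficients of the h_i along an
   ultrafilter, together with dual families of vectors and linear forms certifying
   the lower bounds; they generate an algebra of countable dimension, which has a
   point because K is uncountable and algebraically closed. That point is the
   required h. *)

Set Implicit Arguments.
Unset Strict Implicit.
Unset Printing Implicit Defensive.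

Import Order.TTheory GRing.Theory Num.Theory.
Import numFieldNormedType.Exports.
Local Open Scope classical_set_scope.
Local Open Scope ring_scope.

(** * Dickson's lemma and the basis theorem *)

(** Induction on the number of coordinates compared. A list that works for the first [j] coordinates
    also serves every monomial whose next exponent is at least the maximum [N] over that list; the
    finitely many smaller exponents are treated slice by slice. *)
Lemma dickson n (M : set 'X_{1..n}) : exists L : seq 'X_{1..n},
  (forall l, l \in L -> M l) /\
  (forall m, M m -> exists2 l, l \in L & (l <= m)%MM).
Proof.
suff coordP : forall (j : nat) (M' : set 'X_{1..n}), exists L : seq 'X_{1..n},
    (forall l, l \in L -> M' l) /\
    (forall m, M' m ->
       exists2 l, l \in L & forall i : 'I_n, (i < j)%N -> (l i <= m i)%N).
  have [L [LM ML]] := coordP n M; exists L; split=> // m /ML[l lL lm].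
  by exists l => //; apply/mnm_lepP => i; apply: lm.
elim=> [|j IH] {}M.
  have [[m Mm]|M0] := pselect (exists m, M m).
    exists [:: m]; split=> [l|l _]; first by rewrite inE => /eqP->.
    by exists m; rewrite ?inE.
  by exists [::]; split=> // m Mm; case: M0; exists m.
have [jn|nj] := ltnP j n; last first.
  have [L [LM ML]] := IH M; exists L; split=> // m /ML[l lL lm].
  by exists l => // i ij; apply: lm; apply: leq_trans (ltn_ord i) nj.
pose J := Ordinal jn.
have [L [LM ML]] := IH M.
pose N := \max_(l <- L) l J.
have [Lv LvP] := choice (fun v => IH [set m | M m /\ m J = v]).
exists (L ++ flatten [seq Lv v | v <- iota 0 N]); split.
  move=> l; rewrite mem_cat => /orP[/LM//|/flatten_mapP[v _ lv]].
  by have [/(_ l lv)[]] := LvP v.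
move=> m Mm; have [mN|Nm] := ltnP (m J) N.
  have [_ /(_ m (conj Mm erefl))[l lv lm]] := LvP (m J).
  exists l.
    by rewrite mem_cat; apply/orP; right; apply/flatten_mapP; exists (m J); rewrite ?mem_iota.
  move=> i; rewrite ltnS leq_eqVlt => /orP[/eqP ij|/lm//].
  have -> : i = J by apply/val_inj.
  by have [/(_ l lv)[_ ->]] := LvP (m J).
have [l lL lm] := ML m Mm; exists l; first by rewrite mem_cat lL.
move=> i; rewrite ltnS leq_eqVlt => /orP[/eqP ij|/lm//].
have -> : i = J by apply/val_inj.
by apply: leq_trans Nm; rewrite /N; apply: (@leq_bigmax_seq _ _ _ (fun l : 'X_{1..n} => l J)).
Qed.

(* Hilbert's basis theorem for the ideal of [Z]: leading monomials are cancelled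
   by elements of a Groebner basis. *)
Lemma zariski_closed_fin (K : fieldType) (T : finType) (Z : set (T -> K)) :
  zariski_closed Z -> exists L : seq {mpoly K[#|T|]},
    Z = [set v | forall p, p \in L -> p.@[fun i => v (enum_val i)] = 0].
Proof.
move=> [S ZE]; pose ev (v : T -> K) (p : {mpoly K[#|T|]}) := p.@[fun i => v (enum_val i)].
pose I := [set p | forall v, Z v -> ev v p = 0].
have [L [LI IL]] := dickson [set mlead p | p in [set p | I p /\ p != 0]].
have [g gP] : exists g : 'X_{1..#|T|} -> {mpoly K[#|T|]},
    forall l, l \in L -> I (g l) /\ g l != 0 /\ mlead (g l) = l.
  have /choice[g gP] : forall l, exists p, l \in L -> I p /\ p != 0 /\ mlead p = l; last by exists g.
  move=> l; have [/LI[p [Ip p0] pl]|] := boolP (l \in L); first by exists p.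
  by exists 0.
exists [seq g l | l <- L]; rewrite eqEsubset; split=> v.
  by move=> Zv p /mapP[l /gP[Il _] ->]; apply: Il.
move=> gv; rewrite ZE => p Sp.
have : I p by move=> w; rewrite ZE; apply.
move: {2}(mlead p) (erefl (mlead p)) => m; elim/(@ltmwf #|T|): m p {Sp} => m IH p mE Ip.
have [->|p0] := eqVneq p 0; first by rewrite mevalE big1 // => i _; rewrite mcoeff0 mul0r.
have [l lL lm] : exists2 l, l \in L & (l <= m)%MM by apply: IL; exists p.
have [Ig [g0 gl]] := gP _ lL.
pose c := mleadc p / mleadc (g l).
have c0 : c != 0 by rewrite mulf_neq0 ?invr_eq0 ?mleadc_eq0.
pose t := c *: ('X_[m - l] * g l).
have X0 : 'X_[K, m - l] != 0 by rewrite -mleadc_eq0 mleadXm mcoeffX eqxx oner_eq0.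
have tm : mlead t = m by rewrite mleadZ // mleadM // mleadXm gl submK.
have tc : t@_m = p@_m.
  have -> : p@_m = mleadc p by rewrite mE.
  have qm : mlead ('X_[m - l] * g l) = m by rewrite mleadM // mleadXm gl submK.
  have := mleadcM 'X_[m - l] (g l).
  rewrite mleadXm mcoeffX eqxx mul1r gl submK // -/(mleadc _) => E.
  by rewrite mcoeffZ E /c gl divfK // -[X in _@_X]gl mleadc_eq0.
have evt : ev v t = 0 by rewrite /ev mevalZ mevalM (gv (g l) (map_f g lL)) !mulr0.
suff : ev v (p - t) = 0 by rewrite /ev mevalB -/(ev v t) evt subr0.
have Ipt : I (p - t).
  move=> w Zw; have := Ip w Zw; have := Ig w Zw.
  by rewrite /ev mevalB mevalZ mevalM => -> ->; rewrite !mulr0 subr0.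
have [->|pt0] := eqVneq (p - t) 0.
  by rewrite /ev mevalE big1 // => i _; rewrite mcoeff0 mul0r.
apply: (IH (mlead (p - t)) _ (p - t) erefl Ipt); rewrite lt_neqAle; apply/andP; split.
  apply: contraNneq pt0 => E; rewrite -mleadc_eq0 E mcoeffB tc subrr //.
by apply: le_trans (mleadB_le _ _) _; rewrite mE tm joinxx.
Qed.

(** * Ideals and primes *)

Section Ideals.
Context {A : comNzRingType}.
Implicit Types (I J P Q S : set A) (x y : A).

Lemma is_ideal_gen S : is_ideal (ideal_gen S).
Proof.
split=> [J [[]]//|x y xS yS J [JI SJ]|a x xS J [JI SJ]].
  by case: (JI) => _ + _; apply; [apply: xS|apply: yS].
by case: (JI) => _ _; apply; apply: xS.
Qed.

Lemma ideal_gen_sub S J : is_ideal J -> S `<=` J -> ideal_gen S `<=` J.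
Proof. by move=> JI SJ; apply: smallest_sub. Qed.

Lemma idealN I x : is_ideal I -> I x -> I (- x).
Proof. by move=> [_ _ IM] Ix; rewrite -mulN1r; apply: IM. Qed.

Lemma idealB I x y : is_ideal I -> I x -> I y -> I (x - y).
Proof. by move=> II Ix Iy; have [_ ID _] := II; apply: ID => //; apply: idealN. Qed.

Lemma idealBP I x y : is_ideal I -> I (x - y) -> I y -> I x.
Proof. by move=> [_ ID _] Ixy Iy; rewrite -(subrK y x); apply: ID. Qed.

Lemma ideal_sum I (T : Type) (r : seq T) (p : pred T) (F : T -> A) :
  is_ideal I -> (forall i, p i -> I (F i)) -> I (\sum_(i <- r | p i) F i).
Proof. by move=> [I0 ID _] IF; apply: big_ind. Qed.

Lemma ideal1 I : is_ideal I -> I 1 -> I = setT.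
Proof.
by move=> [_ _ IM] I1; apply/seteqP; split=> // x _; rewrite -[x]mulr1; apply: IM.
Qed.

Lemma prime_idealP P : prime_ideal P -> is_ideal P. Proof. by case. Qed.

Lemma ideal_gen_rangeP k (f : 'I_k -> A) x :
  ideal_gen (range f) x <-> exists a : 'I_k -> A, x = \sum_i a i * f i.
Proof.
split=> [|[a ->]]; last first.
  apply: ideal_sum => [|i _]; first exact: is_ideal_gen.
  by have [_ _] := is_ideal_gen (range f); apply; apply: sub_gen_smallest; exists i.
apply: (ideal_gen_sub (J := [set x | exists a : 'I_k -> A, x = \sum_i a i * f i])).
  split=> [|y z [a ->] [b ->]|c y [a ->]].
  - by exists (fun=> 0); rewrite big1 // => i _; rewrite mul0r.
  - by exists (fun i => a i + b i); rewrite -big_split; apply: eq_bigr => i _; rewrite mulrDl.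
  - by exists (fun i => c * a i); rewrite mulr_sumr; apply: eq_bigr => i _; rewrite mulrA.
move=> _ [i _ <-]; exists (fun j => (j == i)%:R).
by rewrite (bigD1 i) //= eqxx mul1r big1 ?addr0 // => j /negbTE ->; rewrite mul0r.
Qed.

Definition add_elt I x : set A := [set z | exists a, I (z - a * x)].

Lemma is_ideal_add_elt I x : is_ideal I -> is_ideal (add_elt I x).
Proof.
move=> II; have [I0 ID IM] := II; split=> [|y z [a Ia] [b Ib]|c y [a Ia]].
- by exists 0; rewrite mul0r subr0.
- by exists (a + b); rewrite mulrDl opprD addrACA; apply: ID.
- by exists (c * a); rewrite -mulrA -mulrBr; apply: IM.
Qed.

Lemma sub_add_elt I x : I `<=` add_elt I x.
Proof. by move=> y Iy; exists 0; rewrite // mul0r subr0. Qed.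

Lemma add_elt_mem I x : is_ideal I -> add_elt I x x.
Proof. by move=> [I0 _ _]; exists 1; rewrite // mul1r subrr. Qed.

Lemma add_elt_sub I J x : is_ideal J -> I `<=` J -> J x -> add_elt I x `<=` J.
Proof.
move=> JI IJ Jx z [a /IJ Jz]; apply: idealBP Jz _ => //.
by have [_ _] := JI; apply.
Qed.

Definition colon I x : set A := [set z | I (x * z)].

Lemma is_ideal_colon I x : is_ideal I -> is_ideal (colon I x).
Proof.
move=> [I0 ID IM]; split=> [|y z Iy Iz|c y Iy]; rewrite /colon /=.
- by rewrite mulr0.
- by rewrite mulrDr; apply: ID.
- by rewrite mulrCA; apply: IM.
Qed.

Lemma sub_colon I x : is_ideal I -> I `<=` colon I x.
Proof. by move=> [_ _ IM] y Iy; apply: IM. Qed.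

Lemma is_ideal_bigcup (F : set (set A)) : F !=set0 -> total_on F subset ->
  (forall J, F J -> is_ideal J) -> is_ideal (\bigcup_(J in F) J).
Proof.
move=> [J0 FJ0] Ftot FI; split.
- by exists J0 => //; have [] := FI _ FJ0.
- move=> x y [J1 F1 J1x] [J2 F2 J2y].
  have [J12|J21] := Ftot _ _ F1 F2.
    by exists J2 => //; have [_ ID _] := FI _ F2; apply: ID => //; apply: J12.
  by exists J1 => //; have [_ ID _] := FI _ F1; apply: ID => //; apply: J21.
- by move=> a x [J FJ Jx]; exists J => //; have [_ _ IM] := FI _ FJ; apply: IM.
Qed.

End Ideals.

Lemma zorn_above (T : Type) (good : set T -> Prop) (I : set T) : good I ->
  (forall F : set (set T), F !=set0 -> total_on F subset -> F `<=` good ->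
     good (\bigcup_(X in F) X)) ->
  exists M, [/\ good M, I `<=` M & forall J, good J -> M `<=` J -> J = M].
Proof.
move=> gI gF.
have [F FP Ftot|M [MP Mmax]] := @Zorn_bigcup T
    [set S | S = set0 \/ (good S /\ I `<=` S)].
  have [[X [FX X0]]|FE] := pselect (exists X, F X /\ X !=set0); last first.
    left; apply/seteqP; split=> // x [X FX Xx].
    by case: FE; exists X; split=> //; exists x.
  pose F' := F `&` [set X | X !=set0].
  have F'P S : F' S -> good S /\ I `<=` S.
    by move=> [/FP[->|//]] [x].
  have -> : \bigcup_(X in F) X = \bigcup_(X in F') X.
    apply/seteqP; split=> x [Y].
      by move=> FY Yx; exists Y => //; split=> //; exists x.
    by move=> [FY _] Yx; exists Y.
  right; split; last by move=> x Ix; exists X => //; apply: (F'P X _).2.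
  apply: gF => [|Y Z [FY _] [FZ _]|Y /F'P[]//]; first by exists X.
  exact: Ftot.
have [gM IM] : good M /\ I `<=` M.
  case: MP => // M0; have [I0|I0] := eqVneq I set0.
    by rewrite M0; split; [rewrite -I0|rewrite I0].
  case: (Mmax I); last by right; split.
  rewrite M0; split=> // I00; case/set0P: I0 => x Ix.
  exact: (I00 x).
exists M; split=> // J gJ MJ; apply/esym/seteqP; split=> // x Jx.
apply: contrapT => Mx; apply: (Mmax J); last first.
  by right; split=> //; apply: subset_trans IM MJ.
by split=> // JM; apply: Mx; apply: JM.
Qed.

Section Primes.
Context {A : comNzRingType}.
Implicit Types (I J P Q S : set A) (x y : A).

(** If [x] and [y] lie outside a maximal such [Q], then Q + (x) and Q + (y) meet [S] in some [s] and
    [t], and x y in [Q] would force s t into [Q]. Maximality stays in the conclusion since S = {1}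
    then yields maximal ideals. *)
Lemma prime_disjoint S I : is_ideal I -> S 1 ->
  (forall x y, S x -> S y -> S (x * y)) -> (forall x, I x -> ~ S x) ->
  exists Q, [/\ prime_ideal Q, I `<=` Q, forall x, Q x -> ~ S x &
    forall J, is_ideal J -> (forall x, J x -> ~ S x) -> Q `<=` J -> J = Q].
Proof.
move=> II S1 SM IS.
have [F F0 Ftot FP|Q [[QI QS] IQ Qmax]] := @zorn_above _
    (fun J => is_ideal J /\ forall x, J x -> ~ S x) I (conj II IS).
  split; first by apply: is_ideal_bigcup => // J /FP[].
  by move=> x [J /FP[_ JS]]; exact: JS.
exists Q; split=> // [|J JI JS QJ]; last exact: Qmax.
split=> //; first by move/QS; apply.
move=> x y Qxy; apply: contrapT => /not_orP[Qx Qy].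
have hit z : ~ Q z -> exists2 s, S s & add_elt Q z s.
  move=> Qz; apply: contrapT => nS; apply: Qz.
  rewrite -(Qmax (add_elt Q z)); first exact: add_elt_mem.
    split; first exact: is_ideal_add_elt.
    by move=> s Qs Ss; apply: nS; exists s.
  exact: sub_add_elt.
have [s Ss [a Qa]] := hit _ Qx; have [t St [b Qb]] := hit _ Qy.
apply: (QS (s * t)); last exact: SM.
have [_ QD QM] := QI.
have -> : s * t = t * (s - a * x) + (a * x * (t - b * y) + a * b * (x * y)). by ring.
by apply: (QD); [exact: QM|apply: (QD); exact: QM].
Qed.

(** Zorn's lemma on complements of primes: the intersection of a chain of primes is prime. *)
Lemma minimal_prime_below I P : prime_ideal P -> I `<=` P ->
  exists2 Q, minimal_prime I Q & Q `<=` P.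
Proof.
move=> PP IP.
have [|F F0 Ftot FP|C [[Q [QP IQ ->]] PQ Cmax]] := @zorn_above _
    (fun C => exists Q, [/\ prime_ideal Q, I `<=` Q & C = ~` Q]) (~` P).
- by exists P.
- exists (\bigcap_(C in F) ~` C).
  have FE C : F C -> prime_ideal (~` C) /\ I `<=` ~` C.
    by move=> /FP[Q [? ? ->]]; rewrite setCK.
  split; last by rewrite setC_bigcap; apply: eq_bigcupr => C _; rewrite setCK.
    split.
    + split=> [C /FE[[[]]]//|x y Ix Iy C FC|a x Ix C FC].
        by have [[[_ CD _] _ _] _] := FE C FC; apply: CD; [apply: Ix|apply: Iy].
      by have [[[_ _ CM] _ _] _] := FE C FC; apply: CM; apply: Ix.
    + by case: F0 => C FC /(_ C FC); have [[]] := FE C FC.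
    + move=> x y Ixy; apply: contrapT => /not_orP[].
      move=> /existsNP[C1 /not_implyP[F1 /contrapT C1x]].
      move=> /existsNP[C2 /not_implyP[F2 /contrapT C2y]].
      (* Of a prime missing [x] and a prime missing [y], the smaller one misses both. *)
      have [C [FC Cx Cy]] : exists C, [/\ F C, C x & C y].
        have [C12|C21] := Ftot _ _ F1 F2; first by exists C2; split=> //; apply: C12.
        by exists C1; split=> //; apply: C21.
      have [[_ _ CP] _] := FE C FC.
      by have [] := CP _ _ (Ixy C FC).
  by move=> x Ix C FC; have [_] := FE C FC; apply.
exists Q; last by move=> x Qx; apply: contrapT => /PQ.
split=> // Q' Q'P IQ' Q'Q.
have : ~` Q' = ~` Q.
  by apply: Cmax; [exists Q'|move=> x Qx /Q'Q].
by move/(congr1 setC); rewrite !setCK.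
Qed.

(* Localising at a minimal prime [Q] makes [x] nilpotent, i.e. [s x^k] vanishes
   for some [s] outside [Q]. *)
Lemma minimal_prime_zero_divisors I Q x :
  radical_ideal I -> minimal_prime I Q -> Q x -> zero_divisors I x.
Proof.
move=> [II Irad] [[QI Q1 QP] IQ Qmin] Qx.
have [[s [k [Qs Isx]]]|nS] := pselect (exists s k, ~ Q s /\ I (s * x ^+ k)).
  right; exists s; first by move=> /IQ.
  case: k Isx => [|k]; first by rewrite expr0 mulr1 => /IQ.
  move=> Isx; apply: (Irad _ k.+1).
  have -> : (x * s) ^+ k.+1 = s ^+ k * (s * x ^+ k.+1).
    by rewrite exprMn mulrC exprSr mulrA.
  by have [_ _] := II; apply.
have [|x1 x2|y Iy|Q' [Q'P IQ' Q'S _]] :=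
    @prime_disjoint [set t | exists s k, ~ Q s /\ t = s * x ^+ k] I II.
- by exists 1, 0%N; rewrite expr0 mulr1.
- move=> [s [k [Qs ->]]] [t [l [Qt ->]]]; exists (s * t), (k + l)%N.
  by split; [move/QP => []|rewrite exprD mulrACA].
- by move=> [s [k [Qs E]]]; apply: nS; exists s, k; rewrite -E.
case: (Q'S x); last by exists 1, 1%N; rewrite mul1r expr1.
rewrite (Qmin Q') // => s Q's; apply: contrapT => Qs.
by apply: (Q'S s Q's); exists s, 0%N; rewrite expr0 mulr1.
Qed.

End Primes.

(** * Standard bases of ideals of power series *)

Section Order.
Context {n : nat} {K : comNzRingType}.
Local Notation A := (pseries n K).
Implicit Types (f g : A) (m : 'X_{1..n}).

(** The ideal m^k in coordinates, by [smaxideal_expP]. *)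
Definition ordge (k : nat) : set A :=
  [set f | forall m, (mdeg m < k)%N -> scoef f m = 0].

Lemma scoef_sum (I : Type) (r : seq I) (p : pred I) (F : I -> A) m :
  scoef (\sum_(i <- r | p i) F i) m = \sum_(i <- r | p i) scoef (F i) m.
Proof. exact: (big_morph (fun f : A => scoef f m)). Qed.

Lemma scoefB f g m : scoef (f - g) m = scoef f m - scoef g m.
Proof. by []. Qed.

Lemma scoefD f g m : scoef (f + g) m = scoef f m + scoef g m.
Proof. by []. Qed.

Lemma scoefM f g m : scoef (f * g) m =
  \sum_(k : 'X_{1..n < (mdeg m).+1, (mdeg m).+1} | m == (k.1 + k.2)%MM)
    scoef f k.1 * scoef g k.2.
Proof. by []. Qed.

Lemma ordgeM k l f g : ordge k f -> ordge l g -> ordge (k + l) (f * g).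
Proof.
move=> fk gl m mkl; rewrite scoefM big1 // => -[[a ad] [b bd]] /= /eqP mE.
have [ak|ka] := ltnP (mdeg a) k; first by rewrite fk // mul0r.
by rewrite gl ?mulr0 // -(ltn_add2l (mdeg a)) -mdegD -mE (leq_trans mkl) // leq_add2r.
Qed.

Lemma ordgeW k l f : (l <= k)%N -> ordge k f -> ordge l f.
Proof. by move=> lk fk m ml; apply: fk; apply: leq_trans lk. Qed.

Lemma is_ideal_ordge k : is_ideal (ordge k).
Proof.
split=> [//|f g fk gk m mk|a f fk]; first by rewrite /= fk // gk // addr0.
by rewrite -[k]add0n; apply: ordgeM.
Qed.

Lemma ordge_eq0 f : (forall k, ordge k f) -> f = 0.
Proof. by move=> f0; apply/pseriesP => m; apply: (f0 (mdeg m).+1). Qed.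

Definition sconst (c : K) : A := PSeries (fun m => c * (m == 0%MM)%:R).
Definition smon m : A := PSeries (fun k => (k == m)%:R).

Lemma scoef_monM m f k :
  scoef (smon m * f) k = if (m <= k)%MM then scoef f (k - m)%MM else 0.
Proof.
have kd := ltnSn (mdeg k); rewrite (scoef_mul _ _ kd).
set p := strunc _ f.
have -> : (strunc (mdeg k).+1 (smon m) * p)@_k = ('X_[m] * p)@_k.
  by apply: mcoeffM_cong kd _ _ => // l ld; rewrite mcoeff_strunc // mcoeffX eq_sym.
case: ifP => mk.
  rewrite mulrC -[in X in _@_X](submK mk) addmC mcoeffMX mcoeff_strunc //.
  by rewrite (leq_ltn_trans (mdegB _ _)).
rewrite mcoeffM big1 // => -[a b] /= /eqP E.
rewrite mcoeffX; case: eqP => [ma|_]; last by rewrite mul0r.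
by move/negP: mk; case; rewrite E ma lem_addr.
Qed.

Lemma scoef_constM c f k : scoef (sconst c * f) k = c * scoef f k.
Proof.
have kd := ltnSn (mdeg k); rewrite (scoef_mul _ _ kd) -[in RHS](mcoeff_strunc f kd) -mcoeffCM.
by apply: mcoeffM_cong kd _ _ => // l ld; rewrite mcoeff_strunc // mcoeffC.
Qed.

Lemma ordge_mon m : ordge (mdeg m) (smon m).
Proof. by move=> k km /=; case: eqP km => // ->; rewrite ltnn. Qed.

(** The initial monomial is the smallest one for the degree order, as befits a local ring: terms of
    low degree dominate. *)
Definition sinit f m := scoef f m != 0 /\ forall k, (k < m)%O -> scoef f k = 0.

Lemma sinit_exists f : f != 0 -> exists m, sinit f m.
Proof.
move=> f0; apply: contrapT => nm; case/eqP: f0; apply/pseriesP => m.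
elim/(@ltmwf n): m => m IH; apply/eqP; apply: contrapT => /negP fm.
by apply: nm; exists m.
Qed.

Lemma sinit_ordge f m k : sinit f m -> ordge k f -> (k <= mdeg m)%N.
Proof. by move=> [fm _] fk; rewrite leqNgt; apply: contra fm => /fk ->. Qed.

End Order.

Section StandardBasis.
Context {n : nat} {K : fieldType}.
Local Notation A := (pseries n K).
Implicit Types (f g : A) (m : 'X_{1..n}) (I J : set A).

(** One reduction step. The order is compatible with products of monomials, so the subtracted
    multiple of [g] starts exactly at [m]; since [m] has degree at least [k], the order of [f] does
    not drop. *)
Lemma sinit_cancel f g m l k : ordge k f -> sinit g l -> (l <= m)%MM ->
  (k <= mdeg m)%N -> (forall m', (m' < m)%O -> scoef f m' = 0) ->
  let f' := f - sconst (scoef f m / scoef g l) * (smon (m - l)%MM * g) in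
  ordge k f' /\ forall m', (m' <= m)%O -> scoef f' m' = 0.
Proof.
move=> fk [gl gl0] lm km f0 f'.
have f'0 m' : (m' <= m)%O -> scoef f' m' = 0.
  rewrite le_eqVlt scoefB scoef_constM scoef_monM => /orP[/eqP->|m'm].
    rewrite lem_subr; have -> : (m - (m - l) = l)%MM.
      by apply/mnmP => i; rewrite !mnmBE subKn //; move/mnm_lepP: lm.
    by rewrite divfK // subrr.
  rewrite (f0 _ m'm) sub0r; apply/eqP; rewrite oppr_eq0; apply/eqP.
  case: ifP => mm'; last by rewrite mulr0.
  rewrite gl0 ?mulr0 //; have := m'm.
  by rewrite -{1}(submK mm') -[in X in (_ < X)%O -> _](submK lm) [(m - l + l)%MM]addmC ltmc_add2l.
split=> // m' m'k; apply: f'0; apply: ltW; apply: lt_mdeg_ltmc.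
exact: leq_trans km.
Qed.

(* Induction on the number of monomials of degree [< k] from the initial one on. *)
Lemma sinit_ind k (Pr : A -> Prop) : (forall f, ordge k f -> Pr f) ->
  (forall f m, sinit f m -> (mdeg m < k)%N ->
    (forall f', (forall m', (m' <= m)%O -> scoef f' m' = 0) -> Pr f') -> Pr f) ->
  forall f, Pr f.
Proof.
move=> P0 PS f.
pose above f := [set m : 'X_{1..n < k} |
  ~~ `[< forall m' : 'X_{1..n}, (m' <= m)%O -> scoef f m' = 0 >]]%SET.
move: {2}(#|above f|) (leqnn #|above f|) => N; elim: N f => [|N IH] f.
  rewrite leqn0 cards_eq0 => /eqP a0; apply: P0 => m mk.
  have : BMultinom mk \notin above f by rewrite a0 inE.
  by rewrite inE negbK => /asboolP; apply.
move=> aN; have [fk|nfk] := pselect (ordge k f); first exact: P0.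
have [|m fm] := @sinit_exists _ _ f.
  by apply/eqP => f0; apply: nfk; rewrite f0; have [] := @is_ideal_ordge n K k.
have mk : (mdeg m < k)%N.
  rewrite ltnNge; apply/negP => km; apply: nfk => m' m'k.
  by apply: (fm.2); apply: lt_mdeg_ltmc; apply: leq_trans km.
apply: (PS f m) => // f' f'0; apply: IH.
rewrite -ltnS; apply: leq_trans aN; apply: proper_card; apply/properP; split.
  apply/fintype.subsetP => m'; rewrite !inE; apply: contra => /asboolP H; apply/asboolP => k' k'm'.
  apply: f'0; apply: ltW; rewrite ltNge; apply/negP => mk'.
  by case/negP: (fm.1); rewrite H // (le_trans mk').
exists (BMultinom mk); rewrite inE ?negbK; last by apply/asboolP.
by apply/asboolP => H; case/negP: (fm.1); rewrite H.
Qed.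

Section Division.
Context (t s : nat) (g : 'I_t -> A) (l : 'I_t -> 'X_{1..n}) (J : set A).
Hypotheses (JI : is_ideal J) (gJ : forall j, J (g j)) (gl : forall j, sinit (g j) (l j)).
Hypotheses (ls : forall j, (mdeg (l j) <= s)%N).
Hypothesis Jl : forall f m, J f -> sinit f m -> exists j, (l j <= m)%MM.

(** The terms of degree [k] are cancelled one initial monomial at a time; as each [l j] has degree
    at most [s], the quotients lose at most [s] in order. *)
Lemma division_step k f : J f -> ordge k f -> exists a : 'I_t -> A,
  (forall j, ordge (k - s) (a j)) /\ ordge k.+1 (f - \sum_j a j * g j).
Proof.
move: f; apply: (@sinit_ind k.+1) => [f fk1 _ _|f m fm mk1 IH Jf fk].
  exists (fun=> 0); split; first by move=> j; have [] := @is_ideal_ordge n K (k - s).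
  by rewrite big1 ?subr0 // => j _; rewrite mul0r.
have km := sinit_ordge fm fk.
have [j lj] := Jl Jf fm.
pose c := scoef f m / scoef (g j) (l j).
pose a0 := sconst c * smon (m - l j)%MM.
have [f'k f'0] := sinit_cancel fk (gl j) lj km fm.2.
set f' := _ - _ in f'k f'0.
have f'E : f' = f - a0 * g j by rewrite /a0 -mulrA.
have [//||//|a [ak fa]] := IH f'.
  by rewrite f'E; apply: idealB => //; have [_ _] := JI; apply.
exists (fun i => a i + (if i == j then a0 else 0)); split.
  move=> i; have [z0 zD zM] := @is_ideal_ordge n K (k - s); apply: zD => //.
  case: ifP => // _; apply: (zM (sconst c)); apply: ordgeW (@ordge_mon n K (m - l j)%MM).
  have -> : mdeg (m - l j) = (mdeg m - mdeg (l j))%N.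
    by rewrite -{2}(submK lj) mdegD addnK.
  by apply: leq_trans (leq_sub2r _ km) _; apply: leq_sub2l.
move: fa; rewrite f'E; congr (ordge _ _).
under [in RHS]eq_bigr do rewrite mulrDl.
rewrite big_split /= opprD addrA -addrA [- _ - _]addrC addrA; congr (_ - _ - _).
by rewrite (bigD1 j) //= eqxx big1 ?addr0 // => i /negbTE ->; rewrite mul0r.
Qed.

(** Iterating [division_step] raises the order of the remainder by one each time, and the quotients
    have orders tending to infinity, so their sum converges m-adically. *)
Lemma division k f : J f -> ordge k f -> exists a : 'I_t -> A,
  (forall j, ordge (k - s) (a j)) /\ f = \sum_j a j * g j.
Proof.
move=> Jf fk.
have /choice[q qP] : forall p : nat * A, exists a : 'I_t -> A,
    J p.2 -> ordge p.1 p.2 ->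
    (forall j, ordge (p.1 - s) (a j)) /\ ordge p.1.+1 (p.2 - \sum_j a j * g j).
  move=> [i h]; have [[Jh hi]|nh] := pselect (J h /\ ordge i h).
    by have [a aP] := division_step Jh hi; exists a.
  by exists (fun=> 0) => ? ?; case: nh.
pose fs := fix fs i := if i is i'.+1 then
  fs i' - \sum_j q ((k + i')%N, fs i') j * g j else f.
pose a i := q ((k + i)%N, fs i).
have fsP i : J (fs i) /\ ordge (k + i) (fs i).
  elim: i => [|i [Ji oi]]; first by rewrite addn0.
  split; last by rewrite addnS; have [] := qP (_, _) Ji oi.
  by apply: idealB => //; apply: ideal_sum => // j _; have [_ _] := JI; apply.
have aP i j : ordge (k + i - s) (a i j).
  by have [Ji oi] := fsP i; have [H _] := qP (_, _) Ji oi; exact: H.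
have fE i : f = fs i + \sum_j (\sum_(i' < i) a i' j) * g j.
  elim: i => [|i IH].
    by rewrite big1 ?addr0 // => j _; rewrite big_ord0 mul0r.
  have -> : \sum_j (\sum_(i' < i.+1) a i' j) * g j =
      \sum_j a i j * g j + \sum_j (\sum_(i' < i) a i' j) * g j.
    by rewrite -big_split; apply: eq_bigr => j _; rewrite big_ord_recr mulrDl addrC.
  by rewrite [LHS]IH /= addrA subrK.
(* For i > mdeg m + s the order k + i - s of [a i j] exceeds the degree of [m], so a finite sum
   gives the coefficient. *)
pose b j : A := PSeries (fun m => \sum_(i < mdeg m + s + 1) scoef (a i j) m).
exists b; split.
  by move=> j m mk /=; rewrite big1 // => i _; apply: aP; lia.
apply/eqP; rewrite -subr_eq0; apply/eqP/ordge_eq0 => N.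
rewrite {1}(fE (N + s)%N) -addrA -sumrB.
have [z0 zD zM] := @is_ideal_ordge n K N; apply: zD.
  by apply: (ordgeW _ (fsP _).2); lia.
apply: ideal_sum => [|j _]; first exact: is_ideal_ordge.
rewrite -mulrBl mulrC; apply: zM => m mN.
rewrite scoefB scoef_sum /= -!(big_mkord xpredT (fun i => scoef (a i j) m)).
rewrite (@big_cat_nat _ _ _ (mdeg m + s + 1) 0 (N + s)) //=; last by lia.
rewrite addrAC subrr add0r big_nat big1 // => i /andP[i1 i2]; apply: aP; lia.
Qed.

End Division.

(** An effective Artin-Rees property: the loss [s] is the largest degree among the finitely many
    initial monomials provided by [dickson], and does not depend on [k] or [f]. *)
Lemma ideal_standard_basis I : is_ideal I -> exists t s (g : 'I_t -> A),
  (forall j, I (g j)) /\ forall k f, I f -> ordge k f ->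
    exists a : 'I_t -> A, (forall j, ordge (k - s) (a j)) /\ f = \sum_j a j * g j.
Proof.
move=> II.
have [L [LI IL]] := dickson [set m | exists2 f, I f & sinit f m].
have /choice[g gP] : forall j : 'I_(size L), exists f : A,
    I f /\ sinit f (tnth (in_tuple L) j).
  move=> j; have [|f If fj] := LI (tnth (in_tuple L) j); rewrite ?mem_tnth //.
  by exists f.
exists (size L), (\max_(l <- L) mdeg l), g; split=> [j|k f If fk]; first by have [] := gP j.
apply: (division (l := tnth (in_tuple L)) II) => // [j|j|j|h m Ih hm].
- by have [] := gP j.
- by have [] := gP j.
- by apply: (@leq_bigmax_seq _ _ _ (fun l : 'X_{1..n} => mdeg l)); rewrite ?mem_tnth.
- have [|l lL lm] := IL m; first by exists h.
  have /tnthP[j lj] : l \in in_tuple L by [].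
  by exists j; rewrite -lj.
Qed.

Lemma ideal_fg I : is_ideal I -> exists t (g : 'I_t -> A), I = ideal_gen (range g).
Proof.
move=> II; have [t [s [g [gI Ig]]]] := ideal_standard_basis II.
exists t, g; apply/seteqP; split.
  by move=> f If; have [//|a [_ ->]] := Ig 0%N f If; apply/ideal_gen_rangeP; exists a.
by apply: ideal_gen_sub => // _ [j _ <-].
Qed.

(** The initial monomial of [f] is 1, so division of 1 by [f] leaves no remainder and inverts
    [f]. *)
Lemma ideal_unit I f : is_ideal I -> I f -> scoef f 0%MM != 0 -> I 1.
Proof.
move=> [_ _ IM] If f0.
have [|||||||a [_ ->]] := @division 1 0 (fun=> f) (fun=> 0%MM) setT _ _ _ _ _ 0 1 => //.
- by split=> // k; rewrite ltNge (lem_leo (m1 := 0%MM)) //; apply/mnm_lepP => i; rewrite mnm0E.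
- by move=> _; rewrite mdeg0.
- by move=> h m _ _; exists ord0; apply/mnm_lepP => i; rewrite mnm0E.
by rewrite big_ord1; apply: IM.
Qed.

End StandardBasis.

(** * Hilbert-Samuel functions *)

Section LinearAlgebra.
Context {K : fieldType}.

(** A subspace of largest dimension inside [S] exhausts [S], since any further vector would enlarge
    it. *)
Lemma vspace_of_set (vT : vectType K) (S : set vT) : S 0 ->
  (forall a u v, S u -> S v -> S (a *: u + v)) ->
  exists U : {vspace vT}, forall v, v \in U <-> S v.
Proof.
move=> S0 SL.
pose P k := `[< exists U : {vspace vT}, (forall v, v \in U -> S v) /\ \dim U = k >].
have exP : exists k, P k.
  exists 0%N; apply/asboolP; exists 0%VS; rewrite dimv0; split=> // v.
  by rewrite memv0 => /eqP->.
have ubP k : P k -> (k <= dim vT)%N.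
  by move=> /asboolP[U [_ <-]]; rewrite -dimvf dimvS // subvf.
case: (ex_maxnP exP ubP) => k /asboolP[U [US dU]] kmax; exists U => v.
split=> [/US//|Sv]; apply: contrapT => /negP Uv.
have : P (\dim (<[v]> + U)).
  apply/asboolP; exists (<[v]> + U)%VS; split=> // w /memv_addP[_ /vlineP[a ->] [u /US Su ->]].
  exact: SL.
move/kmax; rewrite -dU leqNgt => /negP; apply.
rewrite (ltn_leqif (dimv_leqif_sup (addvSr _ _))).
by apply: contra Uv => /subvP; apply; apply: subvP (addvSl _ _) _ (memv_line v).
Qed.

(** Both sides are the dimension of (im f + W) / W, by rank-nullity. *)
Lemma codim_lpreim (aT rT : vectType K) (f : 'Hom(aT, rT)) (W : {vspace rT}) :
  (\dim {:aT} - \dim (f @^-1: W) = \dim (limg f + W) - \dim W)%N.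
Proof.
have kerW : (lker f <= f @^-1: W)%VS by rewrite -lpreim0 lpreimS // sub0v.
have := limg_ker_dim f (f @^-1: W).
rewrite (capv_idPr kerW) -lpreim_cap_limg lpreimK ?capvSr //.
have := limg_ker_dim f fullv; rewrite capfv.
have := dimv_sum_cap (limg f) W; rewrite capvC.
have := dimvS (capvSr W (limg f)).
have := dimvS (addvSr (limg f) W).
lia.
Qed.

End LinearAlgebra.

Section HilbertSamuel.
Context {n : nat} {K : fieldType}.
Local Notation A := (pseries n K).
Implicit Types (f g x : A) (I J : set A) (k l : nat).

Local Notation V k := {ffun 'X_{1..n < k} -> K^o}.

Definition trunc k f : V k := [ffun m : 'X_{1..n < k} => scoef f m].
Definition untrunc k (v : V k) : A := PSeries (fun m => oapp v 0 (insub m)).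

Lemma untruncK k : cancel (@untrunc k) (trunc k).
Proof. by move=> v; apply/ffunP => m; rewrite ffunE /= valK. Qed.

Lemma trunc_eq k f g : trunc k f = trunc k g <-> ordge k (f - g).
Proof.
split=> [fg m mk|fg].
  have /ffunP/(_ (BMultinom mk)) := fg; rewrite !ffunE /= => ->.
  by rewrite subrr.
apply/ffunP => m; rewrite !ffunE; apply/eqP; rewrite -subr_eq0 -scoefB.
by apply/eqP/fg; apply: bmdeg.
Qed.

Lemma truncE k a f g : trunc k (sconst a * f + g) = a *: trunc k f + trunc k g.
Proof. by apply/ffunP => m; rewrite !ffunE scoefD scoef_constM. Qed.

Lemma untruncE k a (u v : V k) :
  untrunc (a *: u + v) = sconst a * untrunc u + untrunc v.
Proof.
apply/pseriesP => m; rewrite scoefD scoef_constM /=.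
by case: insub => [m'|] /=; rewrite ?ffunE // mulr0 addr0.
Qed.

Lemma trunc_untruncM k x f : trunc k (x * untrunc (trunc k f)) = trunc k (x * f).
Proof.
apply/trunc_eq; rewrite -mulrBr.
have [_ _] := @is_ideal_ordge n K k; apply.
by apply/trunc_eq; rewrite untruncK.
Qed.

(** Lifting by [untrunc] gives a linear map for all [k] and [l]. It is used for k = l, as
    multiplication by [x] on A / m^k, and for x = 1, as the projection to A / m^l when l <= k. *)
Definition mult_jets_fun k l x (v : V k) : V l := trunc l (x * untrunc v).

Fact mult_jets_linear k l x : linear (@mult_jets_fun k l x).
Proof. by move=> a u v; rewrite /mult_jets_fun untruncE mulrDr mulrCA truncE. Qed.
HB.instance Definition _ k l x := GRing.isLinear.Build K (V k) (V l) _
  (@mult_jets_fun k l x) (@mult_jets_linear k l x).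

Definition mult_jets k l x : 'Hom(V k, V l) := linfun (@mult_jets_fun k l x).

Lemma mult_jetsE k x f : mult_jets k k x (trunc k f) = trunc k (x * f).
Proof. by rewrite lfunE /= /mult_jets_fun trunc_untruncM. Qed.

Lemma proj_jetsE k l f : (l <= k)%N -> mult_jets k l 1 (trunc k f) = trunc l f.
Proof.
move=> lk; rewrite lfunE /= /mult_jets_fun mul1r; apply/trunc_eq.
by apply: ordgeW lk _; apply/trunc_eq; rewrite untruncK.
Qed.

(** The image of [I] in A / m^k; for an ideal the default 0 never occurs, by [mem_jet_space]. *)
Definition jet_space k I : {vspace (V k)} :=
  xget 0%VS [set U : {vspace (V k)} |
    forall v, v \in U <-> exists2 f, I f & trunc k f = v].

Lemma mem_jet_space k I v : is_ideal I ->
  v \in jet_space k I <-> exists2 f, I f & trunc k f = v.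
Proof.
move=> [I0 ID IM]; rewrite /jet_space; case: xgetP => [U _ /= /(_ v)//|none].
have [||U US] := @vspace_of_set K (V k) [set v | exists2 f, I f & trunc k f = v].
- by exists 0 => //; apply/ffunP => m; rewrite !ffunE.
- move=> a _ _ [f If <-] [g Ig <-]; exists (sconst a * f + g); last by rewrite truncE.
  by apply: ID => //; apply: IM.
by case: (none U).
Qed.

Lemma trunc_jet_space k I f : is_ideal I ->
  trunc k f \in jet_space k I <-> exists2 g, I g & ordge k (f - g).
Proof.
move=> II; rewrite mem_jet_space //; split=> -[g Ig fg]; exists g => //.
  exact/trunc_eq.
exact/esym/trunc_eq.
Qed.

(** The Hilbert-Samuel function: the dimension of A / (I + m^k). *)
Definition hs I k : nat := (\dim {:V k} - \dim (jet_space k I))%N.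

Lemma codim_le k (U W : {vspace (V k)}) : (U <= W)%VS ->
  (\dim {:V k} - \dim W <= \dim {:V k} - \dim U)%N.
Proof. by move=> UW; apply: leq_sub2l; apply: dimvS. Qed.

Lemma truncP k (v : V k) : exists f, v = trunc k f.
Proof. by exists (untrunc v); rewrite untruncK. Qed.

Lemma hs_sub I J k : is_ideal I -> is_ideal J -> I `<=` J -> (hs J k <= hs I k)%N.
Proof.
move=> II JI IJ; apply: codim_le; apply/subvP => v.
by rewrite !mem_jet_space // => -[f If <-]; exists f => //; apply: IJ.
Qed.

Lemma hs_proj I k l : is_ideal I -> (l <= k)%N ->
  (\dim {:V k} - \dim (mult_jets k l 1 @^-1: jet_space l I))%N = hs I l.
Proof.
move=> II lk; rewrite codim_lpreim /hs; congr (_ - _)%N.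
have -> : limg (mult_jets k l 1) = fullv.
  apply/eqP; rewrite eqEsubv subvf; apply/subvP => v _.
  have [f ->] := truncP v; rewrite -(proj_jetsE f lk); exact: memv_img (memvf _).
by rewrite sumfv.
Qed.

Lemma hs_mono I k l : is_ideal I -> (l <= k)%N -> (hs I l <= hs I k)%N.
Proof.
move=> II lk; rewrite -(hs_proj II lk); apply: codim_le; apply/subvP => v.
rewrite mem_jet_space // => -[f If <-].
rewrite -memv_preim proj_jetsE //; apply/trunc_jet_space => //.
by exists f => //; rewrite subrr; have [] := @is_ideal_ordge n K l.
Qed.

Lemma mem_colon_jets I k x f : is_ideal I ->
  trunc k f \in (mult_jets k k x @^-1: jet_space k I)%VS <->
  exists2 g, I g & ordge k (x * f - g).
Proof. by move=> II; rewrite -memv_preim mult_jetsE trunc_jet_space. Qed.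

(** Multiplication by [x] embeds A / ((I + m^k) : x) in A / (I + m^k), with cokernel A / (I + (x) +
    m^k). *)
Lemma hs_add_elt I k x : is_ideal I -> hs I k = (hs (add_elt I x) k +
  (\dim {:V k} - \dim (mult_jets k k x @^-1: jet_space k I)))%N.
Proof.
move=> II; rewrite codim_lpreim /hs.
have -> : jet_space k (add_elt I x) = (limg (mult_jets k k x) + jet_space k I)%VS.
  apply/eqP; rewrite eqEsubv; apply/andP; split; apply/subvP => v.
    rewrite mem_jet_space; last exact: is_ideal_add_elt.
    move=> [f [a Ifa] <-].
    have -> : trunc k f = trunc k (x * a) + trunc k (f - a * x).
      by apply/ffunP => m; rewrite !ffunE [x * a]mulrC scoefB addrC subrK.
    apply: memv_add; last by apply/mem_jet_space => //; exists (f - a * x).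
    by rewrite -mult_jetsE memv_img ?memvf.
  move=> /memv_addP[_ /memv_imgP[u _ ->] [w + ->]].
  rewrite mem_jet_space // => -[g Ig <-].
  apply/mem_jet_space; first exact: is_ideal_add_elt.
  have [f ->] := truncP u; rewrite mult_jetsE.
  exists (x * f + g); last by apply/ffunP => m; rewrite !ffunE.
  by exists f => //; rewrite [f * x]mulrC addrAC subrr add0r.
have WL := dimvS (addvSr (limg (mult_jets k k x)) (jet_space k I)).
have LV := dimvS (subvf (limg (mult_jets k k x) + jet_space k I)).
by rewrite addnBA // subnK.
Qed.

(** I : x is contained in (I + m^k) : x. *)
Lemma hs_colon I k x : is_ideal I ->
  (hs I k <= hs (add_elt I x) k + hs (colon I x) k)%N.
Proof.
move=> II; rewrite (hs_add_elt k x II) leq_add2l; apply: codim_le.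
apply/subvP => v; rewrite mem_jet_space; last exact: is_ideal_colon.
move=> [f Ifx <-]; apply/mem_colon_jets => //; exists (x * f) => //.
by rewrite subrr; have [] := @is_ideal_ordge n K k.
Qed.

(** For [x] in m, I + m^k is contained in (I + m^(k+1)) : x. *)
Lemma hs_add_elt_le I k x : is_ideal I -> ordge 1 x ->
  (hs I k.+1 <= hs (add_elt I x) k.+1 + hs I k)%N.
Proof.
move=> II x1; rewrite (hs_add_elt k.+1 x II) leq_add2l -(hs_proj II (leqnSn k)).
apply: codim_le; apply/subvP => v; have [f ->] := truncP v.
rewrite -memv_preim proj_jetsE // => /trunc_jet_space[//|g Ig fg].
apply/mem_colon_jets => //; exists (x * g); first by have [_ _] := II; apply.
by rewrite -mulrBr -[k.+1]add1n; apply: ordgeM.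
Qed.

(* Write a standard basis of [I + (x)] as [u + v x] with [u] in [I]: if [x f]
   lies in [I + m^k], its expansion along that basis yields [f] in [I + m^(k-s)],
   as [x] is cancellable modulo [I]. *)
Lemma hs_add_elt_ge I x : prime_ideal I -> ~ I x -> exists s, forall k,
  (hs (add_elt I x) k + hs I (k - s) <= hs I k)%N.
Proof.
move=> [II I1 IP] Ix.
have [t [s [g [gJ Jg]]]] := ideal_standard_basis (is_ideal_add_elt x II).
have /choice[b bP] : forall j, exists b, I (g j - b * x).
  by move=> j; have [b] := gJ j; exists b.
have [I0 ID IM] := II.
exists s => k; rewrite [leqRHS](hs_add_elt k x II) leq_add2l.
rewrite -(hs_proj II (leq_subr s k)); apply: codim_le.
apply/subvP => v; have [f ->] := truncP v => /mem_colon_jets[//|h Ih fh].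
rewrite -memv_preim proj_jetsE ?leq_subr //; apply/trunc_jet_space => //.
have [|a [ak fE]] := Jg k (x * f - h) _ fh.
  by exists f => //; rewrite [f * x]mulrC addrAC subrr sub0r; apply: idealN.
exists (f - \sum_j a j * b j); last first.
  rewrite opprB addrC subrK; apply: ideal_sum => [|j _]; first exact: is_ideal_ordge.
  by rewrite mulrC; have [_ _] := @is_ideal_ordge n K (k - s); apply.
have [|//|//] := IP x (f - \sum_j a j * b j).
have -> : x * (f - \sum_j a j * b j) = h + \sum_j a j * (g j - b j * x).
  under [in RHS]eq_bigr do rewrite mulrBr; rewrite sumrB -fE.
  rewrite mulrBr mulr_sumr addrA [h + _]addrC subrK; congr (_ - _).
  by apply: eq_bigr => j _; ring.
by apply: (ID) => //; apply: ideal_sum => // j _; apply: IM.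
Qed.

Lemma hs0 I : hs I 0 = 0%N.
Proof.
apply/eqP; rewrite subn_eq0 dimvS //; apply/subvP => v _.
suff -> : v = 0 by rewrite mem0v.
by apply/ffunP => -[m m0]; exfalso; rewrite ltn0 in m0.
Qed.

Lemma hs_full I k : is_ideal I -> I 1 -> hs I k = 0%N.
Proof.
move=> II I1; apply/eqP; rewrite subn_eq0 dimvS //; apply/subvP => v _.
by apply/mem_jet_space => //; have [f ->] := truncP v; exists f; rewrite ?(ideal1 II I1).
Qed.

Lemma hs_gt0 I k : is_ideal I -> ~ I 1 -> (0 < k)%N -> (0 < hs I k)%N.
Proof.
move=> II I1 k0; rewrite lt0n subn_eq0; apply/negP => dI; apply: I1.
have E : jet_space k I = fullv by apply/eqP; rewrite eqEdim subvf.
have : trunc k 1 \in jet_space k I by rewrite E memvf.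
move=> /trunc_jet_space[//|g Ig /(_ 0%MM)]; rewrite mdeg0 scoefB /= eqxx => /(_ k0) g0.
apply: (ideal_unit II Ig); have : 1 - scoef g 0%MM = 0 by [].
by move/eqP; rewrite subr_eq0 => /eqP <-; apply: oner_neq0.
Qed.

Lemma hs_max I k : is_ideal I -> ordge 1 `<=` I -> (hs I k <= 1)%N.
Proof.
move=> II mI; rewrite leq_subLR.
have line1 : (\dim <[trunc k 1%R]> <= 1)%N by rewrite dim_vline leq_b1.
apply: (@leq_trans (\dim (jet_space k I) + \dim <[trunc k 1%R]>)); last by rewrite leq_add2l.
have [UV _] := dimv_add_leqif (jet_space k I) <[trunc k 1]>.
apply: leq_trans UV; apply: dimvS.
apply/subvP => v _; have [f ->] := truncP v.
have -> : trunc k f = trunc k (f - sconst (scoef f 0%MM)) + scoef f 0%MM *: trunc k 1.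
  by apply/ffunP => m; rewrite !ffunE scoefB subrK.
apply: memv_add; last by rewrite memvZ // memv_line.
apply/mem_jet_space => //; exists (f - sconst (scoef f 0%MM)) => //; apply: mI => m.
by rewrite ltnS leqn0 mdeg_eq0 => /eqP ->; rewrite scoefB /= eqxx mulr1 subrr.
Qed.

End HilbertSamuel.

(** * Krull dimension as the growth rate of the Hilbert-Samuel function *)

Section Chains.
Context {A : comNzRingType}.
Implicit Types (I J P Q : set A).

Lemma dim_ge_le I d e : (d <= e)%N -> dim_ge I e -> dim_ge I d.
Proof.
rewrite -ltnS => de [p [pP Ip pS]]; exists (fun i => p (widen_ord de i)); split=> //.
by move=> i j ij; apply: pS.
Qed.

Lemma dim_ge_sub I J d : I `<=` J -> dim_ge J d -> dim_ge I d.
Proof.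
move=> IJ [p [pP Jp pS]]; exists p; split=> // i.
exact: subset_trans IJ (Jp i).
Qed.

(** The element [x] makes the first inclusion strict: it lies in every [p i] but not in [Q]. *)
Lemma dim_ge_cons I Q x d : prime_ideal Q -> I `<=` Q -> ~ Q x ->
  (exists p : 'I_d.+1 -> set A, [/\ forall i, prime_ideal (p i),
     forall i, Q `<=` p i, forall i, p i x &
     forall i j : 'I_d.+1, (i < j)%N -> p i `<` p j]) ->
  dim_ge I d.+1.
Proof.
move=> QP IQ Qx [p [pP Qp px pS]].
exists (fun i => if unlift ord0 i is Some j then p j else Q); split.
- by move=> i; case: unliftP.
- by move=> i; case: unliftP => // j _; apply: subset_trans IQ (Qp j).
move=> i j; case: (unliftP ord0 j) => [j'|] -> //.
case: (unliftP ord0 i) => [i'|] -> /=; first by rewrite /bump /= !add1n ltnS => /pS.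
by move=> _; split=> // /(_ x (px j')).
Qed.

Lemma has_dim_uniq I d e : has_dim I d -> has_dim I e -> d = e.
Proof.
move=> [d1 d2] [e1 e2]; apply/eqP; rewrite eqn_leq; apply/andP; split.
  by rewrite leqNgt; apply/negP => ed; apply: e2; apply: dim_ge_le d1.
by rewrite leqNgt; apply/negP => ed; apply: d2; apply: dim_ge_le e1.
Qed.

Lemma krull_dimE I d : has_dim I d -> krull_dim I = d.
Proof.
move=> Id; rewrite /krull_dim; case: xgetP => [e _ Ie|/(_ d)//].
exact: has_dim_uniq Ie Id.
Qed.

End Chains.

Section Growth.
Context {n : nat} {K : fieldType}.
Local Notation A := (pseries n K).
Implicit Types (f g x : A) (I J : set A) (d k : nat).

Lemma leq_expn_base a b e : (a <= b)%N -> (a ^ e <= b ^ e)%N.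
Proof. by case: e => // e ab; rewrite leq_exp2r. Qed.

Definition growth_ge I d := exists s, forall k, (0 < k)%N -> (k ^ d <= hs I (s * k))%N.

(** Growth of order at most d - 1. For d = 0 no exponent is left, and the condition becomes I =
    A. *)
Definition growth_lt I d :=
  if d is d'.+1 then exists C, forall k, (hs I k <= C * k.+1 ^ d')%N else I 1.

Lemma growth_ge_lt I d : is_ideal I -> growth_ge I d -> ~ growth_lt I d.
Proof.
move=> II [s Is]; case: d Is => [|d] Is; first by move=> I1; have := Is 1%N isT; rewrite hs_full.
(* This [k] exceeds C (s + 1)^d, while (s k + 1)^d <= (s + 1)^d k^d, so k^(d+1) outgrows the assumed
   bound. *)
move=> [C IC]; pose k := (C * s.+1 ^ d).+1.
have := leq_trans (Is k isT) (IC _).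
rewrite leqNgt => /negP; apply; rewrite expnS.
have : ((s * k).+1 ^ d <= (s.+1 * k) ^ d)%N by apply: leq_expn_base; lia.
rewrite expnMn => H; have k0 : (0 < k ^ d)%N by rewrite expn_gt0.
apply: (@leq_trans (C * s.+1 ^ d * k ^ d).+1).
  by rewrite ltnS -mulnA leq_mul2l H orbT.
by rewrite -/k ltn_mul2r k0 /= /k.
Qed.

(** The union is finitely generated, and a member of the chain that contains the generators equals
    it. *)
Lemma noetherian_chain (F : set (set A)) : F !=set0 -> total_on F subset ->
  (forall J, F J -> is_ideal J) -> F (\bigcup_(J in F) J).
Proof.
move=> F0 Ftot FI; set U := \bigcup_(J in F) J.
have [t [g UE]] := ideal_fg (is_ideal_bigcup F0 Ftot FI).
have gU j : U (g j) by rewrite /U UE; apply: sub_gen_smallest; exists j.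
suff [J FJ Jg] : exists2 J, F J & forall j, J (g j).
  suff -> : U = J by [].
  apply/seteqP; split; last by move=> x Jx; exists J.
  by rewrite /U UE; apply: ideal_gen_sub => [|_ [j _ <-]]; [apply: FI|].
suff H : forall k, exists2 J, F J & forall j : 'I_t, (j < k)%N -> J (g j).
  by have [J FJ Jg] := H t; exists J => // j; exact: Jg j (ltn_ord j).
elim=> [|k [J FJ Jg]]; first by have [J FJ] := F0; exists J.
have [kt|tk] := ltnP k t; last by exists J => // j _; apply: Jg; apply: (leq_trans (ltn_ord j) tk).
have [J' FJ' J'k] := gU (Ordinal kt).
have [J2 [F2 JJ2 J'J2]] : exists J2, [/\ F J2, J `<=` J2 & J' `<=` J2].
  by have [JJ|JJ] := Ftot _ _ FJ FJ'; [exists J'|exists J]; split.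
exists J2 => // j; rewrite ltnS leq_eqVlt => /orP[/eqP jk|/Jg/JJ2//].
by have -> : j = Ordinal kt by [apply/val_inj]; apply: J'J2.
Qed.

(** An ideal [P] maximal with this growth is prime: if x y is in [P] but neither factor is, then P +
    (x) and P : x both grow slowly, hence so does [P] by [hs_colon]. The constants in [growth_lt]
    may vary along a chain, so its union is handled by [noetherian_chain]. *)
Lemma growth_prime I d : is_ideal I -> ~ growth_lt I d ->
  exists P, [/\ prime_ideal P, I `<=` P & ~ growth_lt P d].
Proof.
move=> II nI.
have [F F0 Ftot FP|P [[PI nP] IP Pmax]] := @zorn_above _
    (fun J => is_ideal J /\ ~ growth_lt J d) I (conj II nI).
  by apply: (FP); apply: noetherian_chain => // J /FP[].
exists P; split=> //; split=> //.
  move=> P1; apply: nP; case: d {nI Pmax} => [//|d]; exists 0%N => k.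
  by rewrite hs_full.
have big J y : is_ideal J -> P `<=` J -> J y -> ~ P y -> growth_lt J d.
  by move=> JI PJ Jy Py; apply: contrapT => nJ; apply: Py; rewrite -(Pmax J).
move=> x y Pxy; apply: contrapT => /not_orP[Px Py]; apply: nP.
have := big _ _ (is_ideal_add_elt x PI) (@sub_add_elt _ _ x) (add_elt_mem x PI) Px.
have := big _ y (is_ideal_colon x PI) (sub_colon x PI) Pxy Py.
case: d {nI Pmax big} => [|d] /=.
  by rewrite /colon /= mulr1 => /Px.
move=> [C1 PC1] [C2 PC2]; exists (C1 + C2)%N => k.
rewrite addnC mulnDl; apply: leq_trans (hs_colon k x PI) _; exact: leq_add.
Qed.

(** Summing [hs_add_elt_le] bounds [hs I k] by the sum of the values of [hs] for I + (x) up to [k],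
    which raises the exponent by at most one. *)
Lemma growth_add_elt I x d : is_ideal I -> ordge 1 x -> ~ growth_lt I d.+1 ->
  ~ growth_lt (add_elt I x) d.
Proof.
move=> II x1 nI; have IxI := is_ideal_add_elt x II.
case: d nI => [|d] nI /=; [move=> Ix1|move=> [C IC]]; apply: nI.
  exists 0%N => k; elim: k => [|k IH]; first by rewrite hs0.
  by apply: leq_trans (hs_add_elt_le k II x1) _; rewrite hs_full.
exists C => k; apply: (@leq_trans (C * (k * k.+1 ^ d))); last first.
  by rewrite expnS leq_mul2l leq_mul2r leqnSn !orbT.
elim: k => [|k IH]; first by rewrite hs0.
apply: leq_trans (hs_add_elt_le k II x1) _.
apply: leq_trans (leq_add (IC k.+1) IH) _.
rewrite mulSn mulnDr leq_add2l leq_mul2l leq_mul2l leq_expn_base ?orbT //.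
Qed.

(** A prime [P] above [I] with the same growth starts the chain; the other primes come from P + (x)
    with [x] in m outside [P], where the growth drops by at most one. *)
Lemma dim_ge_growth I d : is_ideal I -> ~ growth_lt I d -> dim_ge I d.
Proof.
elim: d I => [|d IH] I II nI.
  have [P [PP IP _]] := growth_prime II nI.
  by exists (fun=> P); split=> // i j; rewrite !ord1.
have [P [PP IP nP]] := growth_prime II nI; have PI := prime_idealP PP.
(* Were m contained in [P], the function [hs P] would be bounded by 1. *)
have [x x1 Px] : exists2 x, ordge 1 x & ~ P x.
  apply: contrapT => nx; apply: nP; exists 1%N => k.
  apply: leq_trans (hs_max k PI _) _; last by rewrite mul1n expn_gt0.
  by move=> x x1; apply: contrapT => Px; apply: nx; exists x.
have [p [pP Pp pS]] := IH _ (is_ideal_add_elt x PI) (growth_add_elt PI x1 nP).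
apply: (dim_ge_cons PP IP Px); exists p; split=> // i.
  exact: subset_trans (@sub_add_elt _ _ _) (Pp i).
exact: Pp (add_elt_mem x PI).
Qed.

(** Each strict inclusion of primes raises the growth exponent by one: iterating [hs_add_elt_ge]
    accumulates multiples of the function of the next prime [q]. *)
Lemma growth_chain d (p : 'I_d.+1 -> set A) : (forall i, prime_ideal (p i)) ->
  (forall i j : 'I_d.+1, (i < j)%N -> p i `<` p j) -> growth_ge (p ord0) d.
Proof.
elim: d p => [|d IH] p pP pS.
  exists 1%N => k k0; rewrite mul1n expn0; have [pI p1 _] := pP ord0.
  exact: hs_gt0.
have [s1 H1] := IH (fun i => p (lift ord0 i)) (fun i => pP _)
  (fun i j ij => pS (lift ord0 i) (lift ord0 j) ij).
set q := p (lift ord0 ord0) in H1.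
have [pq nqp] : p ord0 `<` q by apply: pS.
have [x qx px] : exists2 x, q x & ~ p ord0 x.
  by apply: contrapT => nx; apply: nqp => x qx; apply: contrapT => px; apply: nx; exists x.
have [s Hs] := hs_add_elt_ge (pP ord0) px.
have pI := prime_idealP (pP ord0); have qI := prime_idealP (pP (lift ord0 ord0)).
have step k : (hs q k + hs (p ord0) (k - s) <= hs (p ord0) k)%N.
  apply: leq_trans (Hs k); rewrite leq_add2r; apply: hs_sub => //; first exact: is_ideal_add_elt.
  exact: add_elt_sub.
(* S >= s absorbs the loss of one iteration, and S >= s1 makes the induction hypothesis apply at
   level S k. *)
pose S := (s + s1)%N.
have iter k t : (t * hs q (S * k) <= hs (p ord0) (S * (k + t)))%N.
  elim: t => [//|t IHt]; rewrite mulSn; apply: leq_trans (step _).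
  apply: leq_add; first by apply: hs_mono => //; rewrite leq_mul2l leq_addr orbT.
  by apply: leq_trans IHt _; apply: hs_mono => //; rewrite addnS mulnS /S; lia.
exists (S * 2)%N => k k0; rewrite -mulnA mul2n -addnn.
apply: leq_trans (iter k k); rewrite expnS leq_mul2l; apply/orP; right.
by apply: leq_trans (H1 k k0) _; apply: hs_mono => //; rewrite leq_mul2r leq_addl orbT.
Qed.

Lemma growth_dim_ge I d : is_ideal I -> dim_ge I d -> growth_ge I d.
Proof.
move=> II [p [pP Ip pS]]; have [s ps] := growth_chain pP pS.
exists s => k k0; apply: leq_trans (ps k k0) _.
by apply: hs_sub => //; apply: prime_idealP.
Qed.

Lemma proper_ideal_sub I : is_ideal I -> ~ I 1 -> I `<=` ordge 1.
Proof.
move=> II I1 x Ix m; rewrite ltnS leqn0 mdeg_eq0 => /eqP ->.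
by apply/eqP; apply: contrapT => /negP x0; apply: I1; exact: (ideal_unit II Ix x0).
Qed.

Lemma ordge1_proper : ~ (ordge 1 : set A) 1.
Proof. by move=> /(_ 0%MM); rewrite mdeg0 /= eqxx => /(_ isT)/eqP; rewrite oner_eq0. Qed.

(** Every proper ideal lies in m, so a maximal ideal above m is m itself. *)
Lemma prime_ordge1 : prime_ideal (ordge 1 : set A).
Proof.
have [||||Q [QP _ Q1 Qmax]] := @prime_disjoint _ [set (1 : A)] (ordge 1).
- exact: is_ideal_ordge.
- by [].
- by move=> x y -> ->; rewrite /= mul1r.
- by move=> x x1 x1E; apply: ordge1_proper; rewrite -x1E.
have [QI nQ1 _] := QP.
rewrite (Qmax (ordge 1)) //; first exact: is_ideal_ordge.
  by move=> x x1 x1E; apply: ordge1_proper; rewrite -x1E.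
exact: proper_ideal_sub.
Qed.

Lemma hsection_sub I J h : is_ideal J -> I `<=` J -> J h -> hsection I h `<=` J.
Proof.
move=> JI IJ Jh; apply: ideal_gen_sub => // x [/IJ//|].
by apply: (@ideal_gen_sub _ [set h] J JI) => _ ->.
Qed.

Lemma sub_hsection I h : I `<=` hsection I h.
Proof. by move=> x Ix; apply: sub_gen_smallest; left. Qed.

Lemma hsection_mem I h : hsection I h h.
Proof. by apply: sub_gen_smallest; right; apply: sub_gen_smallest. Qed.

(** A non-zero-divisor avoids all minimal primes. Hence a minimal prime can be prepended to any
    chain above [h], which bounds the dimension from above; [growth_add_elt] on a single component
    bounds it from below. *)
Lemma krull_dim_hsection I h c : radical_ideal I ->
  (forall P, minimal_prime I P -> has_dim P c) ->
  ~ zero_divisors I h -> ordge 1 h -> krull_dim (hsection I h) = c.-1.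
Proof.
move=> Irad Ic hZ h1; have [II _] := Irad.
have I1 : ~ I 1.
  move=> I1; apply: hZ; left; rewrite (ideal1 II I1) //.
have hQ Q : minimal_prime I Q -> ~ Q h.
  by move=> QP Qh; apply: hZ; apply: minimal_prime_zero_divisors QP Qh.
have [Q QP Qm] := minimal_prime_below prime_ordge1 (proper_ideal_sub II I1).
have [QPr IQ _] := QP; have QI := prime_idealP QPr.
have [Qc nQc] := Ic _ QP.
(* The component [Q] is strictly below m, because [h] lies in m but not in [Q]; thus [c.-1] is a
   true predecessor. *)
have c0 : (0 < c)%N.
  rewrite lt0n; apply/eqP => c0; apply: nQc; rewrite c0.
  apply: (@dim_ge_cons _ Q Q h 0 QPr (@subset_refl _ Q) (hQ _ QP)).
  exists (fun=> ordge 1); split=> [_|_|_|i j] //; first exact: prime_ordge1.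
  by rewrite !ord1.
case: c c0 Ic Qc nQc => // c _ Ic Qc nQc.
apply: krull_dimE; split.
  apply: dim_ge_sub (dim_ge_growth (is_ideal_add_elt h QI) _).
    apply: hsection_sub; first exact: is_ideal_add_elt.
      exact: subset_trans IQ (@sub_add_elt _ _ _).
    exact: add_elt_mem.
  by apply: growth_add_elt => //; apply: growth_ge_lt => //; apply: growth_dim_ge.
move=> [p [pP Ip pS]].
(* Prepending [Q'] to a chain that is too long for the section makes it too long for the component
   [Q']. *)
have [Q' Q'P Q'p] := minimal_prime_below (pP ord0) (subset_trans (@sub_hsection _ _) (Ip ord0)).
have [Q'Pr IQ' _] := Q'P; have [_] := Ic _ Q'P; apply.
apply: (dim_ge_cons Q'Pr (@subset_refl _ Q') (hQ _ Q'P)).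
exists p; split=> // i; last exact: Ip (@hsection_mem _ _).
apply: subset_trans Q'p _; have [->//|i0] := eqVneq i ord0.
by apply: (pS ord0 i _).1; rewrite lt0n.
Qed.

End Growth.

(** * A uniform bound on multiplicities *)

Section Uniform.
Context {n : nat} {K : fieldType}.
Local Notation A := (pseries n K).
Local Notation V k := {ffun 'X_{1..n < k} -> K^o}.
Implicit Types (I J : set A) (f g : A).

Lemma dim_ffun_regular (T : finType) : \dim {:{ffun T -> K^o}} = #|T|.
Proof. by rewrite dimvf /dim /= muln1. Qed.

(** Monomials of the box have degree at most #|T| (e - 1), which is less than [k], so restricting to
    degrees below [k] loses none of them. *)
Lemma card_box (e k : nat) (T : {set 'I_n}) : (0 < e)%N -> (#|T| * e <= k)%N -> (0 < k)%N ->
  (e ^ #|T| <= #|[set m : 'X_{1..n < k} |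
     [forall i, (m i < (if i \in T then e else 1))%N]]%SET|)%N.
Proof.
case: e => // e _ Tk k0.
pose F i := [pred v : 'I_e.+1 | (i \in T) || (v == ord0)].
have <- : #|family F| = (e.+1 ^ #|T|)%N.
  rewrite card_family foldrE big_map big_enum /= -prod_nat_const [RHS]big_mkcond /=.
  apply: eq_big => // i _; case: ifP => iT.
    by rewrite -[RHS]card_ord; apply: eq_card.
  by rewrite -(card1 (@ord0 e)); apply: eq_card.
pose mn (f : {ffun 'I_n -> 'I_e.+1}) := [multinom val (f i) | i < n].
have mnk (f : {ffun 'I_n -> 'I_e.+1}) : f \in family F -> (mdeg (mn f) < k)%N.
  move=> /familyP fF; rewrite mdegE.
  have : (\sum_i mn f i <= #|T| * e)%N.
    rewrite -sum_nat_const [leqRHS]big_mkcond /=; apply: leq_sum => i _; rewrite mnmE.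
    have := fF i; rewrite !inE; case: ifP => /= [_ _|_ /eqP->//].
    by rewrite -ltnS.
  move=> H; apply: leq_ltn_trans H _.
  case: (posnP #|T|) => [->|T0]; first by rewrite mul0n.
  by apply: leq_trans Tk; rewrite ltn_mul2l T0 ltnS leqnn.
pose h (m : 'X_{1..n < k}) : {ffun 'I_n -> 'I_e.+1} := [ffun i => inord (m i)].
set B := [set m | _]%SET.
apply: leq_trans (leq_image_card h B); apply: subset_leq_card.
apply/fintype.subsetP => f fF; apply/fintype.imageP; exists (BMultinom (mnk f fF)).
  rewrite inE; apply/forallP => i /=; rewrite mnmE.
  move/familyP: fF => /(_ i); rewrite !inE; case: ifP => //= _ /eqP-> //.
by apply/ffunP => i; rewrite ffunE /= mnmE inord_val.
Qed.

(* By pigeonhole the polynomials supported on the box meet [J + m^k]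
   nontrivially. *)
Lemma small_box_init (e k : nat) (T : {set 'I_n}) J : is_ideal J ->
  (hs J k < #|[set m : 'X_{1..n < k} |
     [forall i, (m i < (if i \in T then e else 1))%N]]%SET|)%N ->
  exists f m, [/\ J f, sinit f m & forall i, (m i < (if i \in T then e else 1))%N].
Proof.
set B := [set m : 'X_{1..n < k} | _]%SET => JI hB.
pose ext (c : {ffun {m | m \in B} -> K^o}) : V k := [ffun m => if insub m is Some b then c b else 0].
have ext_lin : linear ext.
  move=> a u v; apply/ffunP => m; rewrite !ffunE.
  by case: insub => [b|]; rewrite ?ffunE // scaler0 addr0.
pose extL := HB.pack_for {linear {ffun {m | m \in B} -> K^o} -> V k} ext
  (GRing.isLinear.Build K _ _ _ ext ext_lin).
pose phi := linfun extL.
have phiK : lker phi = 0%VS.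
  apply/eqP; rewrite -subv0; apply/subvP => c; rewrite memv_ker memv0 lfunE /= => /eqP c0.
  apply/eqP/ffunP => b; have /ffunP/(_ (val b)) := c0; rewrite !ffunE valK.
  by [].
have dphi : \dim (limg phi) = #|B|.
  have := limg_ker_dim phi fullv; rewrite phiK capv0 dimv0 add0n => ->.
  by rewrite dim_ffun_regular card_sig; apply: eq_card => m; rewrite inE.
have [v [vphi vJ v0]] : exists v, [/\ v \in limg phi, v \in jet_space k J & v != 0].
  have [I0|I0] := eqVneq (limg phi :&: jet_space k J)%VS 0%VS.
    (* A trivial intersection would embed a space of dimension [#|B|] in A / (J + m^k), whose
       dimension is [hs J k]. *)
    have := dimv_sum_cap (limg phi) (jet_space k J); rewrite I0 dimv0 addn0 dphi => E.
    have := dimvS (subvf (limg phi + jet_space k J)); rewrite E => H.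
    by move: hB; rewrite /hs ltnNge leq_subRL ?dimvS ?subvf // addnC H.
  have := memv_pick (limg phi :&: jet_space k J); rewrite memv_cap => /andP[? ?].
  by exists (vpick (limg phi :&: jet_space k J)); split=> //; rewrite vpick0.
have [f Jf fv] := (mem_jet_space v JI).1 vJ.
have f0 : f != 0.
  apply: contraNneq v0 => f0; rewrite -fv f0; apply/eqP/ffunP => m; by rewrite !ffunE.
have [m fm] := sinit_exists f0.
have mk : (mdeg m < k)%N.
  rewrite ltnNge; apply/negP => km; case/eqP: v0; rewrite -fv.
  apply/ffunP => m'; rewrite !ffunE; apply: (fm.2); apply: lt_mdeg_ltmc.
  exact: leq_trans (bmdeg m') km.
exists f, m; split=> //.
suff : BMultinom mk \in B by rewrite inE => /forallP.
move/memv_imgP: vphi => [c _ vE].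
have : v (BMultinom mk) != 0 by rewrite -fv ffunE; exact: (fm.1).
by rewrite vE lfunE /= ffunE; case: insubP => // /negP; rewrite eqxx.
Qed.

Lemma smon0 : smon 0%MM = 1 :> A.
Proof. by []. Qed.

(** Macaulay's argument: monomials outside [S] can be reduced modulo [J] to higher terms, so the
    monomials of [S] of degree below [l] span A / (J + m^l). *)
Lemma hs_standard J (S : pred 'X_{1..n}) l : is_ideal J ->
  (forall m, ~~ S m -> exists g l0, [/\ J g, sinit g l0 & (l0 <= m)%MM]) ->
  (hs J l <= #|[pred m : 'X_{1..n < l} | S m]|)%N.
Proof.
move=> JI JS; set St := [pred m : _ | _].
pose U := <<[seq trunc l (smon m : A) | m : 'X_{1..n < l} in St]>>%VS.
have dU : (\dim U <= #|St|)%N by apply: leq_trans (dim_span _) _; rewrite size_image.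
have [UV _] := dimv_add_leqif (jet_space l J) U.
rewrite leq_subLR; apply: (@leq_trans (\dim (jet_space l J) + \dim U)); last by rewrite leq_add2l.
apply: leq_trans UV; apply: dimvS; apply/subvP => v _; have [f ->] := truncP v.
move: f; apply: (@sinit_ind n K l) => [f fl|f m fm ml IH].
  have -> : trunc l f = 0 by apply/ffunP => m; rewrite !ffunE; apply: fl; apply: bmdeg.
  exact: mem0v.
(* The initial term of [f] is cancelled by a multiple of an element of [J] or, if [m] is in [S], by
   the monomial itself. *)
suff [g [l0 [gl lm gU]]] : exists g l0, [/\ sinit g l0, (l0 <= m)%MM &
    forall c, trunc l (sconst c * (smon (m - l0)%MM * g)) \in (jet_space l J + U)%VS].
  have f0 : ordge 0 f by [].
  have [_ f'0] := sinit_cancel f0 gl lm (leq0n _) fm.2.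
  set c := _ / _ in f'0; have := IH _ f'0.
  have -> : trunc l f = trunc l (f - sconst c * (smon (m - l0)%MM * g)) +
      trunc l (sconst c * (smon (m - l0)%MM * g)).
    by apply/ffunP => k; rewrite [LHS]ffunE ffunE ffunE ffunE scoefB subrK.
  by move=> H; apply: rpredD (gU c).
have [Sm|nSm] := boolP (S m); last first.
  have [g [l0 [Jg gl lm]]] := JS m nSm; exists g, l0; split=> // c.
  apply: (subvP (addvSl _ _)); apply/mem_jet_space => //.
  exists (sconst c * (smon (m - l0)%MM * g)) => //.
  by have [_ _ JM] := JI; apply: (JM); apply: JM.
exists (smon m), m; split; [split|exact: lepm_refl|move=> c].
- by rewrite /= eqxx oner_neq0.
- by move=> k km /=; case: eqP km => // ->; rewrite ltxx.
apply: (subvP (addvSr _ _)).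
have -> : (m - m = 0)%MM by apply/mnmP => i; rewrite mnmBE mnm0E subnn.
have -> : trunc l (sconst c * (smon 0%MM * smon m)) = c *: trunc l (smon m).
  apply/ffunP => k; rewrite ffunE scoef_constM smon0 mul1r.
  by rewrite [RHS]ffunE ffunE.
apply: memvZ; apply: memv_span; apply/fintype.imageP; exists (BMultinom ml) => //.
Qed.

(** A monomial is encoded by the set of its exponents >= e (2^n choices), its small exponents (e^n)
    and the list of its at most [d] large ones ((l + 1)^d). *)
Lemma card_standard (d e l : nat) : (0 < e)%N ->
  (#|[pred m : 'X_{1..n < l} | (#|[set i | (e <= m i)%N]%SET| <= d)%N]| <=
   2 ^ n * (e ^ n * l.+1 ^ d))%N.
Proof.
case: e => // e _; set St := [pred m : _ | _].
pose big (m : 'X_{1..n < l}) := [set i | (e < m i)%N]%SET.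
pose low (m : 'X_{1..n < l}) : {ffun 'I_n -> 'I_e.+1} :=
  [ffun i => if i \in big m then ord0 else inord (m i)].
(* Past the end of the list [nth] returns [n], which is no element of ['I_n], and the entry becomes
   0. *)
pose high (m : 'X_{1..n < l}) : {ffun 'I_d -> 'I_l.+1} :=
  [ffun j : 'I_d => oapp (fun i : 'I_n => inord (m i)) ord0
     (insub (nth n (map val (enum (big m))) j))].
pose enc m := (big m, (low m, high m)).
have <- : #|{: {set 'I_n} * ({ffun 'I_n -> 'I_e.+1} * {ffun 'I_d -> 'I_l.+1})}| =
    (2 ^ n * (e.+1 ^ n * l.+1 ^ d))%N.
  have cardP : #|{: {set 'I_n}}| = (2 ^ n)%N.
    by rewrite -cardsT -powersetT card_powerset cardsT card_ord.
  by rewrite !card_prod !card_ffun cardP !card_ord.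
have encI : {in St &, injective enc}; last exact: (leq_card_in enc _ encI).
move=> m1 m2; rewrite !inE => m1d m2d [bigE lowE highE].
apply/val_inj/mnmP => i.
have lti (m : 'X_{1..n < l}) j : (m j < l.+1)%N.
  rewrite ltnS; apply: leq_trans (ltnW (bmdeg m)).
  by rewrite mdegE (bigD1 j) //= leq_addr.
have [ib|ib] := boolP (i \in big m1); last first.
  have /ffunP/(_ i) := lowE; rewrite !ffunE -bigE (negbTE ib) => /(congr1 val) /=.
  have ib' : i \notin big m2 by rewrite -bigE.
  by move: ib ib'; rewrite !inE -!leqNgt => ib ib'; rewrite !inordK.
have ib2 : (index (val i) (map val (enum (big m1))) < d)%N.
  apply: leq_trans m1d; rewrite cardE -(size_map val) index_mem.
  by apply: map_f; rewrite mem_enum.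
have /ffunP/(_ (Ordinal ib2)) := highE.
rewrite !ffunE -bigE /= nth_index ?map_f ?mem_enum // valK => /(congr1 val) /=.
by rewrite !inordK.
Qed.

(** A monomial with d + 1 exponents >= e is divisible by the initial monomial that [small_box_init]
    finds in those variables; so only monomials with at most [d] large exponents are standard. *)
Lemma hs_uniform_bound (d e l : nat) J : (0 < e)%N -> is_ideal J ->
  (hs J (d.+1 * e) < e ^ d.+1)%N -> (hs J l <= 2 ^ n * (e ^ n * l.+1 ^ d))%N.
Proof.
move=> e0 JI hJ; apply: leq_trans (card_standard d l e0).
apply: (hs_standard (S := fun m => (#|[set i | (e <= m i)%N]%SET| <= d)%N)) => // m.
rewrite -ltnNge => dm.
have [T] : exists T : {set 'I_n}, (T \subset [set i | (e <= m i)%N]%SET) && (#|T| == d.+1).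
  have : (0 < 'C(#|[set i | (e <= m i)%N]%SET|, d.+1))%N by rewrite bin_gt0.
  rewrite -cards_draws card_gt0 => /set0Pn[T]; rewrite inE => TP.
  by exists T.
move=> /andP[/fintype.subsetP Tm /eqP Td].
have [|f [l0 [Jf fl l0e]]] := @small_box_init e (d.+1 * e)%N T J JI.
  apply: leq_trans hJ _; rewrite -Td; apply: card_box => //.
  by rewrite Td muln_gt0 e0.
exists f, l0; split=> //; apply/mnm_lepP => i.
have := l0e i; case: ifP => [/Tm|_]; last by rewrite ltnS leqn0 => /eqP->.
by rewrite inE => em li; apply: leq_trans em; apply: ltnW.
Qed.

(** Along a strict chain of ideals containing J + m^k the value of [hs] at [k] strictly
    decreases. *)
Lemma quot_length_le J k : is_ideal J ->
  (quot_length (ideal_add J (ideal_exp smaxideal k)) <= hs J k)%N.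
Proof.
move=> JI; rewrite /quot_length; case: xgetP => [l _ [[p [pI Ip pS]] _]|//].
have Jp i : J `<=` p i.
  by move=> x Jx; apply: (Ip i); apply: sub_gen_smallest; left.
have mp i : ordge k `<=` p i.
  move=> x xk; apply: (Ip i); apply: sub_gen_smallest; right.
  exact/smaxideal_expP.
have lt_hs (i j : 'I_l.+1) : (i < j)%N -> (hs (p j) k < hs (p i) k)%N.
  move=> ij; have [pij npij] := pS i j ij.
  rewrite ltnNge; apply/negP => H; apply: npij => x pjx.
  have sub : (jet_space k (p i) <= jet_space k (p j))%VS.
    apply/subvP => v; rewrite !mem_jet_space // => -[f pf <-].
    by exists f => //; apply: pij.
  have E : jet_space k (p i) = jet_space k (p j).
    apply/eqP; rewrite eqEdim sub /=; move: H; rewrite /hs.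
    by rewrite leq_sub2lE //; apply: dimvS; apply: subvf.
  have : trunc k x \in jet_space k (p i).
    by rewrite E; apply/mem_jet_space => //; exists x.
  move=> /trunc_jet_space[//|g pg xg].
  by apply: (idealBP (pI i) _ pg); apply: mp.
have H (i : nat) : (i <= l)%N -> (i + hs (p (inord i)) k <= hs (p ord0) k)%N.
  elim: i => [_|i IH il]; first by rewrite (_ : inord 0 = ord0) //; apply/val_inj; rewrite /= inordK.
  apply: leq_trans (IH (ltnW il)); rewrite addSnnS leq_add2l; apply: lt_hs.
  by rewrite !inordK // ltnS // ltnW.
have := H l (leqnn l); have := hs_sub k JI (pI ord0) (Jp ord0).
by move=> h1 h2; apply: leq_trans h1; apply: leq_trans h2; apply: leq_addr.
Qed.

Lemma multiplicity_bound (R : realType) (d e : nat) J : (0 < e)%N -> is_ideal J ->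
  has_dim J d -> (hs J (d.+1 * e) < e ^ d.+1)%N ->
  multiplicity R smaxideal J <= (d`! * (2 ^ n * (e ^ n * 3 ^ d)))%:R.
Proof.
move=> e0 JI Jd hJ; rewrite /multiplicity (krull_dimE Jd).
set u := (X in lim (X @ _)).
(* A divergent sequence has limit 0 by convention. *)
have [uc|/dvgP ->] := pselect (cvg (u @ \oo)); last exact: ler0n.
apply: limr_le => //; near=> k; have k0 : (0 < k)%N by near: k; exact: nbhs_infty_gt.
rewrite /u ler_pdivrMr ?exprn_gt0 ?ltr0n // -natrX -!natrM ler_nat.
rewrite -mulnA leq_mul2l; apply/orP; right.
apply: leq_trans (quot_length_le k.+1 JI) _.
apply: leq_trans (hs_uniform_bound k.+1 e0 JI hJ) _.
(* The factor 3^d comes from k + 2 <= 3 k for k >= 1. *)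
rewrite -!mulnA !leq_mul2l -expnMn leq_expn_base ?orbT //; lia.
Unshelve. all: by end_near. Qed.

End Uniform.

(** * Points of countably generated algebras over an uncountable field *)

Lemma infinite_set_seq (T : choiceType) (S : set T) n : ~ finite_set S ->
  exists s : seq T, [/\ uniq s, size s = n & forall x, x \in s -> S x].
Proof.
move=> infS; elim: n => [|n [s [us sn sS]]]; first by exists [::].
have [x [Sx xs]] := infinite_setN0 (infinite_setD infS (finite_seq s)).
exists (x :: s); split; rewrite /= ?sn ?us ?andbT //; first exact/negP.
by move=> y; rewrite inE => /orP[/eqP->|/sS].
Qed.

Lemma uncountable_fiber (T : choiceType) (f : T -> nat) : ~ countable [set: T] ->
  exists n, ~ finite_set [set x | f x = n].
Proof.
move=> cT; apply: contrapT => /forallNP fin; apply: cT.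
have -> : [set: T] = \bigcup_(n in [set: nat]) [set x | f x = n].
  by apply/seteqP; split=> // x _; exists (f x).
apply: bigcup_countable => // n _; apply: finite_set_countable.
exact: contrapT (fin n).
Qed.

Section Points.
Context {K : closedFieldType} {B : comNzRingType}.
Variables (c : {rmorphism K -> B}) (e : nat -> B).
Hypothesis Kuncountable : ~ countable [set: K].
Hypothesis espan : forall b, exists N (a : 'I_N -> K), b = \sum_i c (a i) * e i.

Lemma prime_prod (M : set B) (r : seq B) : prime_ideal M ->
  M (\prod_(x <- r) x) -> exists2 x, x \in r & M x.
Proof.
move=> [_ M1 MP]; elim: r => [|x r IH]; first by rewrite big_nil.
rewrite big_cons => /MP[Mx|/IH[y yr My]].
  by exists x; rewrite // inE eqxx.
by exists y; rewrite // inE yr orbT.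
Qed.

(* If no [b - c a] lay in the maximal ideal [M], uncountably many inverses
   [y a] would lie in a space of countable dimension; a linear relation between
   them makes [b] algebraic over [K] modulo [M]. *)
Lemma maximal_residue (M : set B) (b : B) : prime_ideal M ->
  (forall x, ~ M x -> exists y, M (1 - y * x)) -> exists a, M (b - c a).
Proof.
move=> MP Minv; have [MI M1 Mprime] := MP; have [M0 MD MM] := MI.
apply: contrapT => /forallNP nM.
have /choice[y yP] : forall a, exists y, M (1 - y * (b - c a)).
  by move=> a; apply: Minv.
have /choice[dim dimP] : forall a, exists N, exists q : 'I_N -> K, y a = \sum_i c (q i) * e i.
  by move=> a; apply: espan.
(* Infinitely many of the inverses [y a] lie in the span of the first [N] elements [e i]. *)
have [N infN] := uncountable_fiber dim Kuncountable.
have [s [us sN sS]] := infinite_set_seq N.+1 infN.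
pose a (j : 'I_N.+1) := nth 0 s j.
have a_inj i j : a i = a j -> i = j.
  by move/eqP; rewrite nth_uniq ?sN // => /eqP/val_inj.
have /choice[q qP] : forall j, exists q : 'I_N -> K, y (a j) = \sum_i c (q i) * e i.
  move=> j; have := dimP (a j).
  by have -> : dim (a j) = N by apply: sS; apply: mem_nth; rewrite sN.
pose C := \matrix_(j < N.+1, i < N) q j i.
have [w wC w0] : exists2 w : 'rV_N.+1, (w <= kermx C)%MS & w != 0.
  apply/rowV0Pn; rewrite -mxrank_eq0 mxrank_ker -lt0n subn_gt0.
  by rewrite ltnS rank_leq_col.
have wy : \sum_j c (w 0 j) * y (a j) = 0.
  under eq_bigr => j _ do rewrite qP mulr_sumr.
  rewrite exchange_big big1 //= => i _.
  under eq_bigr => j _ do rewrite mulrA -rmorphM.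
  rewrite -mulr_suml -rmorph_sum.
  have /sub_kermxP/matrixP/(_ 0 i) := wC; rewrite !mxE => wCi.
  rewrite (_ : \sum_j _ = 0) ?rmorph0 ?mul0r // -[RHS]wCi.
  by apply: eq_bigr => j _; rewrite mxE.
(* The numerator of the sum of the w_j / (X - a_j). Its values at the [a j] show that it is nonzero,
   while the relation [wy] puts its value at [b] in [M]. *)
pose F := \sum_j w 0 j *: \prod_(i | i != j) ('X - (a i)%:P).
have Fa j : F.[a j] = w 0 j * \prod_(i | i != j) (a j - a i).
  rewrite /F horner_sum (bigD1 j) //= [X in _ + X]big1 ?addr0.
    by rewrite hornerZ horner_prod; congr (_ * _); apply: eq_bigr => i _; rewrite hornerXsubC.
  move=> i ij; rewrite hornerZ horner_prod (bigD1 j) 1?eq_sym //= hornerXsubC subrr.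
  by rewrite mul0r mulr0.
have F0 : F != 0.
  have /rV0Pn[j wj] := w0; apply/eqP => Fz; have /eqP := Fa j.
  rewrite Fz horner0 eq_sym mulf_eq0 (negbTE wj) /=.
  by apply/negP/prodf_neq0 => i; apply: contraNneq => /eqP; rewrite subr_eq0 => /eqP/a_inj ->.
pose ev (p : {poly K}) := (map_poly c p).[b].
have evM p p' : ev (p * p') = ev p * ev p' by rewrite /ev rmorphM hornerM.
have evXB z : ev ('X - z%:P) = b - c z by rewrite /ev rmorphB /= map_polyX map_polyC hornerXsubC.
have evC z : ev z%:P = c z by rewrite /ev map_polyC hornerC.
have evprod (I : Type) (r : seq I) (P : pred I) (f : I -> {poly K}) :
    ev (\prod_(i <- r | P i) f i) = \prod_(i <- r | P i) ev (f i).
  by rewrite /ev rmorph_prod horner_prod.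
have MF : M (ev F).
  have -> : ev F = \sum_j c (w 0 j) * \prod_(i | i != j) (b - c (a i)).
    rewrite /ev rmorph_sum horner_sum; apply: eq_bigr => j _.
    rewrite -mul_polyC -/(ev _) evM evC evprod; congr (_ * _).
    by apply: eq_bigr => i _.
  pose D := \prod_i (b - c (a i)).
  have -> : \sum_j c (w 0 j) * \prod_(i | i != j) (b - c (a i)) =
     \sum_j c (w 0 j) * (\prod_(i | i != j) (b - c (a i)) - y (a j) * D).
    under [RHS]eq_bigr do rewrite mulrBr mulrA.
    by rewrite sumrB -mulr_suml wy mul0r subr0.
  apply: ideal_sum => // j _; apply: (MM).
  have -> : D = (b - c (a j)) * \prod_(i | i != j) (b - c (a i)) by rewrite /D (bigD1 j).
  set Q := \prod_(i | i != j) _.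
  have -> : Q - y (a j) * ((b - c (a j)) * Q) = Q * (1 - y (a j) * (b - c (a j))) by ring.
  exact: MM.
(* [F] splits into linear factors, so the prime ideal [M] contains some b - c z. *)
have [r FE] := closed_field_poly_normal F.
have := MF; rewrite FE -mul_polyC evM evC => /Mprime[Mc|].
  apply: M1; rewrite -(rmorph1 c) -(mulVf (x := lead_coef F)) ?lead_coef_eq0 //.
  by rewrite rmorphM; apply: (MM).
rewrite evprod -(big_map (fun z => ev ('X - z%:P)) xpredT id) => /(prime_prod MP)[_ /mapP[z _ ->]].
by rewrite evXB; apply: nM.
Qed.

(** A Nullstellensatz in countable dimension: by [maximal_residue] a maximal ideal above [I] has
    residue field [K], and [phi] is the residue map. *)
Lemma algebra_point (I : set B) : is_ideal I -> ~ I 1 -> exists phi : {rmorphism B -> K},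
  (forall a, phi (c a) = a) /\ (forall b, I b -> phi b = 0).
Proof.
move=> II I1.
have [//|//|x y -> ->|x Ix x1|M [MP IM _ Mmax]] := @prime_disjoint B [set 1] I.
- by rewrite /= mulr1.
- by apply: I1; rewrite -x1.
have [MI M1 _] := MP; have [M0 MD MM] := MI.
have Minv x : ~ M x -> exists y, M (1 - y * x).
  move=> Mx; apply: contrapT => nM; apply: Mx; rewrite -(Mmax (add_elt M x)).
  - exact: add_elt_mem.
  - exact: is_ideal_add_elt.
  - by move=> z [y My] z1; apply: nM; exists y; rewrite -z1.
  - exact: sub_add_elt.
have /choice[phi phiP] := fun b => maximal_residue b MP Minv.
(* The residue is unique since [M] contains no nonzero constant; the morphism laws follow. *)
have phiE b a : M (b - c a) -> phi b = a.
  move=> Mb; apply/eqP; rewrite -subr_eq0; apply: contrapT => /negP a0; apply: M1.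
  rewrite -(rmorph1 c) -(mulVf a0) rmorphM; apply: (MM); rewrite rmorphB.
  have -> : c (phi b) - c a = (b - c a) - (b - c (phi b)) by ring.
  exact: idealB.
have phiB : zmod_morphism phi.
  move=> x y; apply: phiE; rewrite rmorphB.
  have -> : x - y - (c (phi x) - c (phi y)) = (x - c (phi x)) - (y - c (phi y)) by ring.
  exact: idealB.
have phiM : monoid_morphism phi.
  split; first by apply: phiE; rewrite rmorph1 subrr.
  move=> x y; apply: phiE; rewrite rmorphM.
  have -> : x * y - c (phi x) * c (phi y) = y * (x - c (phi x)) + c (phi x) * (y - c (phi y)) by ring.
  by apply: (MD); apply: (MM).
exists (HB.pack_for {rmorphism B -> K} phi (GRing.isZmodMorphism.Build B K phi phiB)
  (GRing.isMonoidMorphism.Build B K phi phiM)); split=> [a|b Ib] /=.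
  by apply: phiE; rewrite subrr.
by apply: phiE; rewrite rmorph0 subr0; apply: IM.
Qed.

End Points.

(** * The algebra generated by countably many sequences *)

Section SequenceAlgebra.
Context {K : fieldType} {Ix : countType}.
Variable u : Ix -> nat -> K.

Definition seq_monomial (s : seq Ix) : nat -> K := fun i => \prod_(j <- s) u j i.

Definition seq_algebra : {pred (nat -> K)} := fun f =>
  `[< exists r : seq (K * seq Ix), forall i, f i = \sum_(p <- r) p.1 * seq_monomial p.2 i >].

Lemma seq_algebra_subring : subring_closed seq_algebra.
Proof.
split.
- apply/asboolP; exists [:: (1, [::])] => i.
  by rewrite big_seq1 /seq_monomial big_nil mulr1.
- move=> f g /asboolP[r fr] /asboolP[s gs]; apply/asboolP.
  exists (r ++ [seq (- p.1, p.2) | p <- s]) => i.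
  rewrite big_cat big_map /= -fr.
  under eq_bigr do rewrite mulNr.
  by rewrite sumrN -gs.
- move=> f g /asboolP[r fr] /asboolP[s gs]; apply/asboolP.
  exists [seq (p.1 * q.1, p.2 ++ q.2) | p <- r, q <- s] => i.
  rewrite big_allpairs_dep /=.
  have -> : (f * g) i = f i * g i by [].
  rewrite fr gs mulr_suml; apply: eq_bigr => p _; rewrite mulr_sumr.
  by apply: eq_bigr => q _; rewrite /seq_monomial big_cat mulrACA.
Qed.
HB.instance Definition _ :=
  GRing.isSubringClosed.Build (nat -> K) seq_algebra seq_algebra_subring.

Record seqalg := SeqAlg { seqval : nat -> K; seqvalP : seqval \in seq_algebra }.
HB.instance Definition _ := [isSub for seqval].
HB.instance Definition _ := [Choice of seqalg by <:].
HB.instance Definition _ := [SubChoice_isSubComNzRing of seqalg by <:].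

Lemma seqvalE (b b' : seqalg) : (forall i, seqval b i = seqval b' i) -> b = b'.
Proof. by move=> bb'; apply/val_inj/funext. Qed.

Definition seqalg_ev i (b : seqalg) : K := seqval b i.

Fact seqalg_evB i : zmod_morphism (seqalg_ev i). Proof. by []. Qed.
Fact seqalg_evM i : monoid_morphism (seqalg_ev i). Proof. by []. Qed.
HB.instance Definition _ i :=
  GRing.isZmodMorphism.Build seqalg K (seqalg_ev i) (seqalg_evB i).
HB.instance Definition _ i :=
  GRing.isMonoidMorphism.Build seqalg K (seqalg_ev i) (seqalg_evM i).

Fact seqalg_const_subproof (a : K) : (fun=> a) \in seq_algebra.
Proof.
apply/asboolP; exists [:: (a, [::])] => i.
by rewrite big_seq1 /seq_monomial big_nil mulr1.
Qed.
Definition seqalg_const a := SeqAlg (seqalg_const_subproof a).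

Fact seqalg_constB : zmod_morphism seqalg_const.
Proof. by move=> a b; apply: seqvalE. Qed.
Fact seqalg_constM : monoid_morphism seqalg_const.
Proof. by split=> [|a b]; apply: seqvalE. Qed.
HB.instance Definition _ :=
  GRing.isZmodMorphism.Build K seqalg seqalg_const seqalg_constB.
HB.instance Definition _ :=
  GRing.isMonoidMorphism.Build K seqalg seqalg_const seqalg_constM.

Fact seqalg_mon_subproof s : seq_monomial s \in seq_algebra.
Proof.
by apply/asboolP; exists [:: (1, s)] => i; rewrite big_seq1 mul1r.
Qed.
Definition seqalg_mon s := SeqAlg (seqalg_mon_subproof s).

Lemma seqalg_span (b : seqalg) : exists N (a : 'I_N -> K),
  b = \sum_i seqalg_const (a i) * seqalg_mon (odflt [::] (unpickle i)).
Proof.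
have /asboolP[r br] := seqvalP b.
(* [r] may repeat a monomial, so the coefficient at [i] collects all terms whose monomial has code
   [i]. *)
exists (\max_(p <- r) pickle p.2).+1, (fun i => \sum_(p <- r | pickle p.2 == val i) p.1).
apply: seqvalE => t; rewrite -[RHS]/(seqalg_ev t _) rmorph_sum br.
transitivity (\sum_(i < (\max_(p <- r) pickle p.2).+1)
    \sum_(p <- r | pickle p.2 == val i) p.1 * seq_monomial (odflt [::] (unpickle (val i))) t);
  last by apply: eq_bigr => i _; rewrite -mulr_suml.
rewrite (exchange_big_dep xpredT) //= [LHS]big_seq [RHS]big_seq; apply: eq_bigr => p pr.
have pN : (pickle p.2 < (\max_(p <- r) pickle p.2).+1)%N.
  by rewrite ltnS; apply: (@leq_bigmax_seq _ _ _ (fun p : K * seq Ix => pickle p.2)).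
rewrite (big_pred1 (Ordinal pN)) => [|i]; last by rewrite eq_sym.
congr (_ * seq_monomial _ _).
exact: (congr1 (odflt [::]) (esym (pickleK p.2))).
Qed.

End SequenceAlgebra.

(** The elements of the sequence algebra vanishing along [U] form a proper ideal, and [phi] is a
    point of its zero set: polynomial identities between the [u j] that hold along [U] persist at
    [phi]. *)
Lemma limit_point (K : closedFieldType) (Ix : countType) (u : Ix -> nat -> K)
    (U : set_system nat) : ~ countable [set: K] -> ProperFilter U ->
  exists (B : comNzRingType) (c : {rmorphism K -> B}) (ev : nat -> {rmorphism B -> K})
    (phi : {rmorphism B -> K}) (x : Ix -> B),
  [/\ forall i a, ev i (c a) = a, forall a, phi (c a) = a,
     forall i j, ev i (x j) = u j i &
     forall b, U [set i | ev i b = 0] -> phi b = 0].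
Proof.
move=> Kunc UF; pose ev i : {rmorphism seqalg u -> K} := @seqalg_ev _ _ u i.
pose I : set (seqalg u) := [set b | U [set i | ev i b = 0]].
have II : is_ideal I.
  split=> [|x y Ix0 Iy0|a x Ix0].
  - by apply: filterS filterT => i _; exact: (rmorph0 (ev i)).
  - by apply: filterS2 Ix0 Iy0 => i xi yi; apply: etrans (rmorphD (ev i) x y) _; rewrite xi yi addr0.
  - by apply: filterS Ix0 => i xi; apply: etrans (rmorphM (ev i) a x) _; rewrite xi mulr0.
have I1 : ~ I 1.
  move=> I1; apply: (@filter_not_empty _ U); apply: filterS I1 => i i1.
  by have := rmorph1 (ev i); rewrite i1 => /eqP; rewrite eq_sym oner_eq0.
have [phi [phic phiI]] := @algebra_point K (seqalg u) (@seqalg_const _ _ u)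
  (fun k => seqalg_mon u (odflt [::] (unpickle k))) Kunc (@seqalg_span _ _ u) I II I1.
exists (seqalg u), (@seqalg_const _ _ u), ev, phi, (fun j => seqalg_mon u [:: j]).
by split=> // i j; rewrite /ev /= /seqalg_ev /= /seq_monomial big_seq1.
Qed.

(** * Singular ideals *)

Section Jacobians.
Context {n : nat} {K : fieldType}.
Local Notation A := (pseries n K).
Implicit Types (f g : A) (I J : set A).

Lemma sderivM (j : 'I_n) f g : sderiv j (f * g) = sderiv j f * g + f * sderiv j g.
Proof.
(* A derivative reads coefficients one degree higher, so truncation below degree mdeg m + 2 reduces
   the claim to the product rule for polynomials. *)
apply/pseriesP => m; rewrite scoefD; set d := (mdeg m).+2.
have md : (mdeg (m + U_(j)) < d)%N by rewrite mdegD mdeg1 addn1.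
have derE h k : (mdeg k < (mdeg m).+1)%N ->
    (strunc (mdeg m).+1 (sderiv j h))@_k = (mderiv j (strunc d h))@_k.
  move=> kd; rewrite mcoeff_strunc // mcoeff_deriv mcoeff_strunc //.
  by rewrite mdegD mdeg1 addn1.
have strE h k : (mdeg k < (mdeg m).+1)%N ->
    (strunc (mdeg m).+1 h)@_k = (strunc d h)@_k.
  by move=> kd; rewrite !mcoeff_strunc // leqW.
rewrite [LHS](congr1 (fun x => x *+ _) (scoef_mul f g md)) -mcoeff_deriv mderivM mcoeffD.
rewrite !(scoef_mul _ _ (ltnSn (mdeg m))).
congr (_ + _); apply/esym; apply: mcoeffM_cong (ltnSn (mdeg m)) _ _ => k kd;
  by [rewrite derE|rewrite strE].
Qed.

Lemma sderiv_sum (j : 'I_n) k (F : 'I_k -> A) :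
  sderiv j (\sum_i F i) = \sum_i sderiv j (F i).
Proof.
apply: (big_morph (sderiv j)) => [f g|]; apply/pseriesP => m /=.
  by rewrite mulrnDl.
by rewrite mul0rn.
Qed.

Lemma prod_ideal_cong (T : Type) (s : seq T) (x y : T -> A) I : is_ideal I ->
  (forall i, I (x i - y i)) -> I (\prod_(i <- s) x i - \prod_(i <- s) y i).
Proof.
move=> II xy; have [I0 ID IM] := II; elim: s => [|i s IH].
  by rewrite !big_nil subrr.
rewrite !big_cons; set X := \prod_(_ <- s) x _; set Y := \prod_(_ <- s) y _.
have -> : x i * X - y i * Y = X * (x i - y i) + y i * (X - Y) by ring.
by apply: (ID); apply: (IM).
Qed.

Lemma det_ideal_cong r I (M N : 'M[A]_r) : is_ideal I ->
  (forall i j, I (M i j - N i j)) -> I (\det M - \det N).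
Proof.
move=> II MN; have [I0 ID IM] := II.
rewrite /determinant -sumrB; apply: ideal_sum => // s _; rewrite -mulrBr; apply: (IM).
by apply: prod_ideal_cong => // i; apply: MN.
Qed.

(* Multilinear expansion of the determinant in the rows (half of the
   Cauchy-Binet formula). *)
Lemma det_mulmx_rows r k (C : 'M[A]_(r, k)) (D : 'M[A]_(k, r)) :
  \det (C *m D) = \sum_(p : {ffun 'I_r -> 'I_k})
    (\prod_i C i (p i)) * \det (\matrix_(i, j) D (p i) j).
Proof.
rewrite /determinant; under eq_bigr => s _ do
  (under eq_bigr do rewrite mxE; rewrite bigA_distr_bigA mulr_sumr).
rewrite exchange_big; apply: eq_bigr => p _; rewrite mulr_sumr.
apply: eq_bigr => s _; rewrite big_split mulrCA; congr (_ * (_ * _)).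
by apply: eq_bigr => i _; rewrite mxE.
Qed.

(** Writing f = C F, the product rule gives Jac(f) = C Jac(F) modulo [I], and [det_mulmx_rows]
    expands the minors of the product. *)
Lemma minors_jacobian_sub r k l (F : 'I_k -> A) (f : 'I_l -> A) I :
  I = ideal_gen (range F) -> (forall a, I (f a)) ->
  minors r (jacobian f) `<=` ideal_gen (I `|` minors r (jacobian F)).
Proof.
move=> IE fI _ [s [t ->]].
have II : is_ideal I by rewrite IE; apply: is_ideal_gen.
set S := ideal_gen _; have SI : is_ideal S by apply: is_ideal_gen.
have /choice[C fC] : forall a, exists C : 'I_k -> A, f a = \sum_b C b * F b.
  by move=> a; apply/ideal_gen_rangeP; rewrite -IE.
pose M := \matrix_(i < r, b < k) C (s i) b.
pose D := \matrix_(b < k, j < r) jacobian F b (t j).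
have IS x : I x -> S x by move=> Ix; apply: sub_gen_smallest; left.
apply: (idealBP SI (y := \det (M *m D))).
  apply: IS; apply: det_ideal_cong => // i j; rewrite !mxE fC sderiv_sum -sumrB.
  apply: ideal_sum => // b _; rewrite sderivM !mxE addrK.
  by have [_ _] := II; apply; rewrite IE; apply: sub_gen_smallest; exists b.
rewrite det_mulmx_rows; apply: ideal_sum => // p _.
have [_ _ SM] := SI; apply: SM; apply: sub_gen_smallest; right.
by exists p, t; congr (\det _); apply/matrixP => i j; rewrite !mxE.
Qed.

Lemma sing_ideal_atE alpha k (F : 'I_k -> A) I : I = ideal_gen (range F) ->
  sing_ideal_at alpha I = ideal_gen (I `|` minors (n - alpha) (jacobian F)).
Proof.
move=> IE; apply/seteqP; split; apply: ideal_gen_sub; try exact: is_ideal_gen.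
  move=> x [Ix|[l [f [fE xf]]]]; first by apply: sub_gen_smallest; left.
  apply: (minors_jacobian_sub IE _ xf) => a.
  by rewrite fE; apply: sub_gen_smallest; exists a.
move=> x [Ix|xF]; first by apply: sub_gen_smallest; left.
by apply: sub_gen_smallest; right; exists k, F.
Qed.

End Jacobians.

Definition cons_fam (T : Type) k (x : T) (F : 'I_k -> T) : 'I_k.+1 -> T :=
  fun i => if unlift ord0 i is Some j then F j else x.

Section SingularSection.
Context {n : nat} {K : fieldType}.
Local Notation A := (pseries n K).

Lemma hsection_gen k (F : 'I_k -> A) h :
  hsection (ideal_gen (range F)) h = ideal_gen (range (cons_fam h F)).
Proof.
apply/seteqP; split.
  apply: hsection_sub; first exact: is_ideal_gen.
    apply: ideal_gen_sub => [|_ [i _ <-]]; first exact: is_ideal_gen.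
    by apply: sub_gen_smallest; exists (lift ord0 i); rewrite // /cons_fam liftK.
  by apply: sub_gen_smallest; exists ord0; rewrite // /cons_fam unlift_none.
apply: ideal_gen_sub => [|_ [i _ <-]]; first exact: is_ideal_gen.
rewrite /cons_fam; case: unliftP => [j _|_]; last exact: hsection_mem.
by apply: sub_hsection; apply: sub_gen_smallest; exists j.
Qed.

(** The minor size [r] is kept fixed instead of being read off the dimension of the section, so that
    the ideal depends on [h] in a uniform way. *)
Definition sing_section k (F : 'I_k -> A) r h : set A :=
  ideal_gen (hsection (ideal_gen (range F)) h `|` minors r (jacobian (cons_fam h F))).

Lemma sing_ideal_hsection k (F : 'I_k -> A) h :
  let I := hsection (ideal_gen (range F)) h in
  sing_ideal I = sing_section F (n - krull_dim I) h.
Proof. by apply: sing_ideal_atE; apply: hsection_gen. Qed.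

End SingularSection.

(** * Certificates for lower bounds on Hilbert-Samuel functions *)

Section Certificates.
Context {n : nat} {K : fieldType}.
Local Notation A := (pseries n K).
Local Notation V k := {ffun 'X_{1..n < k} -> K^o}.

(* [R] lists linear forms on [A / m^k] killing [J], and [L] a dual family; these
   conditions are polynomial equations in the entries of [L] and [R]. *)
Definition hs_cert (k N : nat) (J : set A) (L R : nat -> 'X_{1..n} -> K) :=
  (forall a b, (a < N)%N -> (b < N)%N ->
     \sum_(m : 'X_{1..n < k}) L a m * R b m = (a == b)%:R) /\
  (forall b w, (b < N)%N -> J w -> \sum_(m : 'X_{1..n < k}) R b m * scoef w m = 0).

Lemma trunc_basis k (v : V k) : v = \sum_(m : 'X_{1..n < k}) v m *: trunc k (smon m).
Proof.
apply/ffunP => m; rewrite sum_ffunE (bigD1 m) //= big1 => [|l lm].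
  by rewrite !ffunE /= eqxx addr0 [RHS]mulr1.
by rewrite !ffunE /=; case: eqP => [/val_inj ml|_]; [rewrite ml eqxx in lm|rewrite [LHS]mulr0].
Qed.

(** [L] is part of a basis of a complement of the image of [J], and [R] gives the coordinates after
    projecting onto this complement along that image. *)
Lemma hs_cert_exists k N J : is_ideal J -> (N <= hs J k)%N ->
  exists L R, hs_cert k N J L R.
Proof.
move=> JI NJ; pose W := jet_space k J; pose C := (W^C)%VS.
have dC : (N <= \dim C)%N by rewrite dimv_compl.
have CW : (C :&: W = 0)%VS by rewrite capvC capv_compl.
pose ell b (v : V k) : K := if insub b is Some j
  then coord (vbasis C) j (daddv_pi C W v) else 0.
have ellE b (v : V k) : \sum_(m : 'X_{1..n < k}) v m * ell b (trunc k (smon m)) = ell b v.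
  rewrite {2}(trunc_basis v) /ell; case: insubP => [j _ _|_]; last first.
    by rewrite big1 // => m _; rewrite mulr0.
  by rewrite !linear_sum; apply: eq_bigr => m _; rewrite !linearZ.
exists (fun a m => oapp (fun m' : 'X_{1..n < k} => (vbasis C)`_a m') 0 (insub m)).
exists (fun b m => ell b (trunc k (smon m))); split=> [a b aN bN|b w bN Jw].
  under eq_bigr do rewrite valK /=.
  rewrite ellE /ell; case: insubP => [j _ jb|]; last by rewrite (leq_trans bN dC).
  have aC : (a < \dim C)%N by apply: leq_trans dC.
  rewrite daddv_pi_id //; last by apply: vbasis_mem; rewrite mem_nth ?size_tuple.
  rewrite -[a]/(val (Ordinal aC)) coord_free ?(basis_free (vbasisP C)) //.
  by rewrite -val_eqE -jb eq_sym.
under eq_bigr => m _ do rewrite mulrC.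
have -> : \sum_(m : 'X_{1..n < k}) scoef w m * ell b (trunc k (smon m)) = ell b (trunc k w).
  by rewrite -ellE; apply: eq_bigr => m _; rewrite ffunE.
have wW : trunc k w \in W by apply/mem_jet_space => //; exists w.
have wCW : trunc k w \in (C + W)%VS by apply: (subvP (addvSr _ _)).
have := daddv_pi_add CW wCW; rewrite [daddv_pi W C _]daddv_pi_id 1?capvC //.
move/eqP; rewrite -subr_eq0 addrK => /eqP w0.
by rewrite /ell w0; case: insub => [j|//]; rewrite linear0.
Qed.

(** Applying [R b] to a combination of the [L a] that lies in the image of [J] shows that its
    coefficient at [b] is 0; hence the [L a] are independent modulo [J]. *)
Lemma hs_cert_le k N J L R : is_ideal J -> hs_cert k N J L R -> (N <= hs J k)%N.
Proof.
move=> JI [LR RJ]; pose W := jet_space k J.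
pose X := [tuple [ffun m : 'X_{1..n < k} => L a m : K^o] | a < N].
have indep (g : 'I_N -> K) : \sum_a g a *: X`_a \in W -> forall b, g b = 0.
  rewrite mem_jet_space // => -[w Jw wE] b.
  have := RJ b w (ltn_ord b) Jw.
  have wm (m : 'X_{1..n < k}) : scoef w m = \sum_a g a * L a m.
    have /ffunP/(_ m) := wE; rewrite ffunE => ->; rewrite sum_ffunE.
    by apply: eq_bigr => a _; rewrite -tnth_nth tnth_mktuple !ffunE.
  move=> <-; transitivity (\sum_a g a * \sum_(m : 'X_{1..n < k}) L a m * R b m).
    rewrite (bigD1 b) //= LR // eqxx mulr1 big1 ?addr0 // => a ab.
    by rewrite LR // (negbTE (ab : (val a != val b))) mulr0.
  under [RHS]eq_bigr => m _ do rewrite wm mulr_sumr.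
  rewrite exchange_big; apply: eq_bigr => a _; rewrite mulr_sumr.
  by apply: eq_bigr => m _; ring.
have Xfree : free X.
  by apply/freeP => g g0; apply: indep; rewrite g0 mem0v.
have XW : (<<X>> :&: W = 0)%VS.
  apply/eqP; rewrite -subv0; apply/subvP => v; rewrite memv_cap memv0 => /andP[vX vW].
  rewrite (coord_span vX) in vW *; rewrite big1 // => a _.
  by rewrite (indep _ vW) scale0r.
have := dimvS (subvf (<<X>> + W)); rewrite dimv_disjoint_sum // (eqP Xfree) size_tuple => H.
by rewrite leq_subRL; [rewrite addnC|apply: leq_trans (leq_addl _ _) H].
Qed.

End Certificates.

(** * Coefficientwise change of rings *)

Section Map.
Context {n : nat} {R S : comNzRingType} (psi : {rmorphism R -> S}).

Definition smap (f : pseries n R) : pseries n S := PSeries (fun m => psi (scoef f m)).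

Fact smapB : zmod_morphism smap.
Proof. by move=> f g; apply/pseriesP => m /=; rewrite rmorphB. Qed.
Fact smapM : monoid_morphism smap.
Proof.
split=> [|f g]; apply/pseriesP => m /=; first by rewrite rmorph_nat.
by rewrite rmorph_sum; apply: eq_bigr => k _; rewrite rmorphM.
Qed.
HB.instance Definition _ := GRing.isZmodMorphism.Build (pseries n R) (pseries n S) smap smapB.
HB.instance Definition _ := GRing.isMonoidMorphism.Build (pseries n R) (pseries n S) smap smapM.

Lemma smap_jacobian k (F : 'I_k -> pseries n R) :
  map_mx smap (jacobian F) = jacobian (smap \o F).
Proof.
apply/matrixP => i j; rewrite !mxE; apply/pseriesP => m /=.
by rewrite rmorphMn.
Qed.

End Map.

(** * The limit hypersurface *)

Lemma ultra_bigcup (U : set_system nat) k (S : 'I_k -> set nat) : UltraFilter U ->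
  U (\bigcup_(i in [set: 'I_k]) S i) -> exists i, U (S i).
Proof.
move=> UU Uk; apply: contrapT => /forallNP nS; have [UF _] := UU.
apply: (@filter_not_empty _ U).
have : U [set t | forall i, (~` S i) t].
  by apply: filter_forall => i; have [/nS|] := in_ultra_setVsetC (S i) UU.
by apply: filterS2 Uk => t [i _ Sit] /(_ i).
Qed.

Lemma mmap_eval (K : fieldType) (B : comNzRingType) (c : {rmorphism K -> B})
    (psi : {rmorphism B -> K}) N (v : 'I_N -> B) (p : {mpoly K[N]}) :
  (forall a, psi (c a) = a) -> psi (mmap c v p) = p.@[fun i => psi (v i)].
Proof.
move=> psic; rewrite mevalE /mmap rmorph_sum; apply: eq_bigr => m _.
rewrite rmorphM psic; congr (_ * _); rewrite /mmap1 rmorph_prod.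
by apply: eq_bigr => i _; rewrite rmorphXn.
Qed.

(* [G j] is cut out by finitely many polynomials, so that the ultrafilter singles
   out one of them that does not vanish. *)
Lemma constructible_ultra (K : fieldType) (T : finType) (C : set (T -> K))
    (U : set_system nat) (v : nat -> T -> K) : UltraFilter U -> constructible C ->
  (forall i, C (v i)) -> exists (S : set {mpoly K[#|T|]}) (q : {mpoly K[#|T|]}),
  [/\ forall p, S p -> U [set i | p.@[fun t => v i (enum_val t)] = 0],
      U [set i | q.@[fun t => v i (enum_val t)] != 0] &
      forall w : T -> K, (forall p, S p -> p.@[fun t => w (enum_val t)] = 0) ->
        q.@[fun t => w (enum_val t)] != 0 -> C w].
Proof.
move=> UU [k [F [G [Fc Gc CE]]]] Cv; have [UF _] := UU.
have [j Uj] : exists j, U [set i | (F j `\` G j) (v i)].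
  apply: (@ultra_bigcup U k (fun j => [set i | (F j `\` G j) (v i)]) UU).
  apply: filterS filterT => i _; have := Cv i; rewrite CE => -[j _ FGj].
  by exists j.
have [S FE] := Fc j; have [L GE] := zariski_closed_fin (Gc j).
have [a Ua] : exists a : 'I_(size L),
    U [set i | (tnth (in_tuple L) a).@[fun t => v i (enum_val t)] != 0].
  apply: (@ultra_bigcup U _ (fun a => [set i |
     (tnth (in_tuple L) a).@[fun t => v i (enum_val t)] != 0]) UU).
  apply: filterS Uj => i [_ Gi]; apply: contrapT => nL; apply: Gi; rewrite GE => p pL.
  apply/eqP; apply: contrapT => /negP p0; apply: nL.
  have /tnthP[a pa] : p \in in_tuple L by [].
  by exists a => //=; rewrite -pa.
exists S, (tnth (in_tuple L) a); split=> // [p Sp|w wS wa].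
  by apply: filterS Uj => i [] + _; rewrite FE => /(_ p Sp).
rewrite CE; exists j => //; split; first by rewrite FE.
by rewrite GE => /(_ _ (mem_tnth a (in_tuple L))); apply/eqP.
Qed.

(** The generators of the limit ideal (constant series, the equation [hB], the minors) lift to
    series over [B] whose images under every [ev i] lie in the ideal of the i-th section. Inclusion
    in [Z] can be tested on such lifts. *)
Lemma sing_section_smap (n : nat) (K : fieldType) (B : comNzRingType)
    (c : {rmorphism K -> B}) (ev : nat -> {rmorphism B -> K}) (phi : {rmorphism B -> K})
    (evc : forall i a, ev i (c a) = a) (phic : forall a, phi (c a) = a)
    k (F : 'I_k -> pseries n K) r (hB : pseries n B) (Z : set (pseries n K)) :
  is_ideal Z ->
  (forall wB : pseries n B,
     (forall i, sing_section F r (smap (ev i) hB) (smap (ev i) wB)) ->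
     Z (smap phi wB)) ->
  sing_section F r (smap phi hB) `<=` Z.
Proof.
move=> ZI ZP.
have smapc (psi : {rmorphism B -> K}) : (forall a, psi (c a) = a) ->
    forall f : pseries n K, smap psi (smap c f) = f.
  by move=> psic f; apply/pseriesP => m /=; rewrite psic.
apply: ideal_gen_sub => // w [|[s [t ->]]].
  move: w; apply: hsection_sub => //.
    move=> w Xw; rewrite -(smapc phi phic w); apply: ZP => i.
    rewrite smapc //; apply: sub_gen_smallest; left; exact: sub_hsection.
  by apply: ZP => i; apply: sub_gen_smallest; left; apply: hsection_mem.
pose FB := cons_fam hB (smap c \o F).
have FBE (psi : {rmorphism B -> K}) : (forall a, psi (c a) = a) ->
    smap psi (\det (mxsub s t (jacobian FB))) =
    \det (mxsub s t (jacobian (cons_fam (smap psi hB) F))).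
  move=> psic; rewrite -det_map_mx map_mxsub smap_jacobian; congr (\det (mxsub s t (jacobian _))).
  apply: funext => i; rewrite /FB /cons_fam /=; case: unliftP => [j _|_] //=.
  exact: smapc.
rewrite -(FBE phi phic); apply: ZP => i.
rewrite (FBE (ev i) (evc i)); apply: sub_gen_smallest; right.
by exists s, t.
Qed.

Lemma limit_section (K : closedFieldType) (n k r d : nat) (F : 'I_k -> pseries n K)
    (P : set (pseries n K)) (h : nat -> pseries n K) : ~ countable [set: K] ->
  AmAC P -> (forall i, P (h i)) ->
  (forall e, (0 < e)%N -> \forall i \near \oo,
     (e ^ d <= hs (sing_section F r (h i)) (d * e))%N) ->
  exists2 g, P g & growth_ge (sing_section F r g) d.
Proof.
move=> Kunc [Pi [Pc _ PE]] hP hsP.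
have [U [UU oU]] := ultraFilterLemma (F := \oo : set_system nat) _.
have [UF _] := UU.
have exSq l : exists (S : set {mpoly K[#|{: 'X_{1..n < l}}|]})
    (q : {mpoly K[#|{: 'X_{1..n < l}}|]}),
    [/\ forall p, S p ->
          U [set i | p.@[fun t => @jet n K l (h i) (enum_val t)] = 0],
      U [set i | q.@[fun t => @jet n K l (h i) (enum_val t)] != 0] &
      forall w : jets l, (forall p, S p -> p.@[fun t => w (enum_val t)] = 0) ->
        q.@[fun t => w (enum_val t)] != 0 -> Pi l w].
  apply: (@constructible_ultra K _ (Pi l) U (fun i => @jet n K l (h i)) UU (Pc l)) => i.
  by have := hP i; rewrite PE; apply.
(* The types of [S l] and [q l] depend on [l], hence the choice through [cid]. *)
pose S l := sval (cid (exSq l)); pose q l := sval (cid (svalP (cid (exSq l)))).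
have SqP l : [/\ forall p, S l p -> U [set i | p.@[fun t => @jet n K l (h i) (enum_val t)] = 0],
      U [set i | (q l).@[fun t => @jet n K l (h i) (enum_val t)] != 0] &
      forall w : jets l, (forall p, S l p -> p.@[fun t => w (enum_val t)] = 0) ->
        (q l).@[fun t => w (enum_val t)] != 0 -> Pi l w].
  exact: (svalP (cid (svalP (cid (exSq l))))).
pose Z i := sing_section F r (h i).
have ZI i : is_ideal (Z i) by apply: is_ideal_gen.
have /choice[LR LRP] : forall ei : nat * nat,
    exists LR : (nat -> 'X_{1..n} -> K) * (nat -> 'X_{1..n} -> K),
    (ei.1 ^ d <= hs (Z ei.2) (d * ei.1))%N ->
    hs_cert (d * ei.1) (ei.1 ^ d) (Z ei.2) LR.1 LR.2.
  move=> [e i] /=; have [H|nH] := pselect (e ^ d <= hs (Z i) (d * e))%N; last first.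
    by exists (fun=> fun=> 0, fun=> fun=> 0).
  by have [L [R LR]] := hs_cert_exists (ZI i) H; exists (L, R).
have LRU e : (0 < e)%N ->
    U [set i | hs_cert (d * e) (e ^ d) (Z i) (LR (e, i)).1 (LR (e, i)).2].
  by move=> e0; apply: filterS (oU _ (hsP e e0)) => i /(LRP (e, i)).
(* Recorded along the sequence: the coefficients of [h i], the entries of the certificates ([true]
   for the vectors, [false] for the forms), and the inverse of [q l] at the jet of [h i]. *)
pose Ix : countType := ('X_{1..n} + bool * nat * nat * 'X_{1..n} + nat)%type.
pose u (j : Ix) (i : nat) : K := match j with
  | inl (inl m) => scoef (h i) m
  | inl (inr (b, e, a, m)) => if b then (LR (e, i)).1 a m else (LR (e, i)).2 a m
  | inr l => ((q l).@[fun t => @jet n K l (h i) (enum_val t)])^-1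
  end.
have [B [c [ev [phi [x [evc phic evx phiU]]]]]] := limit_point u Kunc UF.
pose hB : pseries n B := PSeries (fun m => x (inl (inl m))).
have evh i : smap (ev i) hB = h i by apply/pseriesP => m /=; rewrite evx.
exists (smap phi hB).
  rewrite PE => l; have [Sz qU SqPi] := SqP l.
  pose v (t : 'I_#|{: 'X_{1..n < l}}|) : B := scoef hB (enum_val t).
  have vE i : (fun t => ev i (v t)) = (fun t => @jet n K l (h i) (enum_val t)).
    by apply: funext => t; rewrite /v /= evx.
  apply: SqPi => [p Sp|].
    rewrite -[LHS](mmap_eval v p phic); apply: phiU; apply: filterS (Sz p Sp) => i /= pi.
    by rewrite (mmap_eval v p (evc i)) vE.
  (* Rabinowitsch's trick: the identity q q^(-1) = 1 holds along [U], so [q l] stays nonzero at the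
     limit. *)
  have /eqP : phi (mmap c v (q l) * x (inr l) - 1) = 0.
    apply: phiU; apply: filterS qU => i /= qi.
    rewrite rmorphB rmorphM rmorph1 evx (mmap_eval v (q l) (evc i)) vE /=.
    by rewrite divff // subrr.
  rewrite rmorphB rmorphM rmorph1 (mmap_eval v (q l) phic) subr_eq0 => qx.
  apply/eqP => q0; have : 1 = 0 :> K.
    by rewrite -(eqP qx) -[X in X * _]/((q l).@[fun t => @jet n K l (smap phi hB) (enum_val t)]) q0 mul0r.
  by move/eqP; rewrite oner_eq0.
exists d => e e0.
pose xL a m := x (inl (inr (true, e, a, m))).
pose xR b m := x (inl (inr (false, e, b, m))).
apply: (@hs_cert_le _ _ _ _ _ (fun a m => phi (xL a m)) (fun b m => phi (xR b m))).
  exact: is_ideal_gen.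
split=> [a b aN bN|].
  apply/eqP; rewrite -subr_eq0 -(rmorph_nat phi).
  under eq_bigr do rewrite -rmorphM; rewrite -rmorph_sum -rmorphB.
  apply/eqP/phiU; apply: filterS (LRU e e0) => i [LRi _] /=.
  rewrite rmorphB rmorph_sum rmorph_nat -(LRi a b aN bN).
  by under eq_bigr do rewrite rmorphM !evx /=; rewrite subrr.
(* Testing all multiples y w turns the common kernel of the limit forms into an ideal, as
   [sing_section_smap] requires. *)
pose kill : set (pseries n K) := [set w | forall (y : pseries n K) b, (b < e ^ d)%N ->
  \sum_(m : 'X_{1..n < d * e}) phi (xR b m) * scoef (y * w) m = 0].
suff Zkill : sing_section F r (smap phi hB) `<=` kill.
  by move=> b w bN /Zkill/(_ 1 b bN); rewrite mul1r.
apply: (sing_section_smap evc phic) => [|wB wBP y b bN].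
  split=> [y b _|w w' wk wk' y b bN|z w wk y b bN].
  - by rewrite mulr0 big1 // => m _; rewrite mulr0.
  - under eq_bigr do rewrite mulrDr scoefD mulrDr.
    by rewrite big_split /= wk // wk' // addr0.
  - by rewrite mulrA wk.
have -> : y = smap phi (smap c y) by apply/pseriesP => m /=; rewrite phic.
rewrite -rmorphM; under eq_bigr do rewrite /= -rmorphM.
rewrite -rmorph_sum; apply: phiU; apply: filterS (LRU e e0) => i [_ Rk] /=.
have Zi : Z i (y * smap (ev i) wB).
  by have [_ _ ZM] := ZI i; apply: ZM; rewrite /Z -(evh i).
have yE : y * smap (ev i) wB = smap (ev i) (smap c y * wB).
  by rewrite rmorphM; congr (_ * _); apply/pseriesP => m /=; rewrite evc.
rewrite rmorph_sum -[RHS](Rk b _ bN Zi) yE.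
by apply: eq_bigr => m _; rewrite rmorphM evx.
Qed.

(** * From unbounded multiplicities to a jump of dimension *)

Unset Implicit Arguments.

Theorem theorem3p13 (R : realType) (K : closedFieldType) (n : nat)
    (X P : set (pseries n K)) (h : nat -> pseries n K) (d : nat) :
  ~ countable [set: K] ->
  radical_ideal X ->
  equidimensional X ->
  AmAC P ->
  zero_divisors X `&` P = set0 ->
  (forall i, P (h i)) ->
  (forall i, has_dim (sing_ideal (hsection X (h i))) d) ->
  multiplicity R smaxideal (sing_ideal (hsection X (h i))) @[i --> \oo]
    --> +oo ->
  exists2 g, P g & dim_ge (sing_ideal (hsection X g)) d.+1.
Proof.
move=> Kunc Xrad [c Xc] PA XP hP hd hmult.
have [XI _] := Xrad; have [k [F XE]] := ideal_fg XI.
(* Sections of X by non-units of [P] all have dimension c - 1, so a single minor size serves them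
   all. *)
pose r := (n - c.-1)%N.
have nZ g : P g -> ~ zero_divisors X g.
  by move=> Pg Zg; have : (zero_divisors X `&` P) g by []; rewrite XP.
have dim_proper (I : set (pseries n K)) l : dim_ge I l -> ~ I 1.
  by move=> [p [pP Ip _]] I1; have [_] := pP ord0; case; apply: Ip.
have singE g : P g -> ordge 1 g -> sing_ideal (hsection X g) = sing_section F r g.
  move=> Pg g1; have := sing_ideal_hsection F g; rewrite -XE /= => ->.
  by rewrite (krull_dim_hsection Xrad Xc (nZ g Pg) g1).
have section_m (I : set (pseries n K)) g : is_ideal I -> hsection X g `<=` I -> ~ I 1 -> ordge 1 g.
  by move=> II gI I1; apply: (proper_ideal_sub II I1); apply: gI; apply: hsection_mem.
(* The singular scheme is nonempty because it has a dimension, so [h i] is not a unit. *)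
have h1 i : ordge 1 (h i).
  apply: (section_m _ _ _ _ (dim_proper _ _ (hd i).1)); first exact: is_ideal_gen.
  by move=> x hx; apply: sub_gen_smallest; left.
have [|g Pg gg] := @limit_section K n k r d.+1 F P h Kunc PA hP.
  (* If the lower bound failed, [multiplicity_bound] would keep the multiplicity below a constant
     depending only on [n], [d] and [e], which it eventually exceeds. *)
  move=> e e0; have /cvgryPgt/(_ _) := hmult.
  move=> /(_ (d`! * (2 ^ n * (e ^ n * 3 ^ d)))%:R); apply: filterS => i mult_i.
  rewrite leqNgt; apply/negP => small; move: mult_i; rewrite ltNge => /negP; apply.
  apply: multiplicity_bound => //; first exact: is_ideal_gen.
  by rewrite singE.
have SI : is_ideal (sing_section F r g) by apply: is_ideal_gen.
have gd := dim_ge_growth SI (growth_ge_lt SI gg).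
exists g => //; rewrite singE //.
(* The limit singular ideal has primes above it, so it is proper and [g] is not a unit; [singE] thus
   applies to [g]. *)
apply: (section_m _ _ SI) (dim_proper _ _ gd).
by move=> x hx; apply: sub_gen_smallest; left; rewrite -XE.
Qed.
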